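(* For every $n\in\mathbb N$, the geometric realization $|\Delta(\mathsf T_n)|$ of the order complex of the poset $\mathsf T_n$ is Cohen–Macaulay over $\mathbb Z$ and homeomorphic to a ball of dimension $\binom{n+1}{2}-1$. The number of maximal chains of $\mathsf T_n$ (equivalently, facets of $\Delta(\mathsf T_n)$) is \[ \frac{\binom{n+1}{2}!\cdot\prod_{a=1}^{n-1}a!}{\prod_{b=1}^n(2b-1)!}. \]
   Context: For nonempty $A,B\subseteq[n]=\{1,\dots,n\}$ write $A\sqsubseteq B$ if there is a two-column semistandard Young tableau whose first column has entry set $A$ and whose second column has entry set $B$; equivalently $\#A\ge\#B$ and $A(k)\le B(k)$ for all $k\le\#B$, where $A(k)$ is the $k$-th smallest element of $A$. This is a partial order (the tableau order); $\mathsf T_n$ is the poset $(2^{[n]}\setminus\{\varnothing\},\sqsubseteq)$. The order complex $\Delta(P)$ of a finite poset $P$ is the simplicial complex whose simplices are the chains of $P$. *)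

(* Defs.v *)
From HB Require Import structures.
From mathcomp Require Import all_boot all_order all_algebra.
From mathcomp Require Import all_classical all_reals all_analysis.
Set Implicit Arguments. Unset Strict Implicit. Unset Printing Implicit Defensive.
Import Order.TTheory GRing.Theory Num.Theory.
Import numFieldNormedType.Exports.

Definition kth_elt (n : nat) (A : {set 'I_n}) (k : nat) : nat :=
  nth 0%N (sort leq [seq val i | i <- enum A]) k.

Definition tab_le (n : nat) (A B : {set 'I_n}) : bool :=
  (#|B| <= #|A|)%N && [forall k : 'I_#|B|, (kth_elt A k <= kth_elt B k)%N].

Definition order_complex_T (n : nat) (s : {set {set 'I_n}}) : bool :=
  [forall a in s, a != finset.set0] &&
  [forall a in s, forall b in s, tab_le a b || tab_le b a].

Section Simplicial.
Variable V : finType.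

(* A simplicial complex is given by its predicate of faces (empty face included).
   Faces with k vertices are the (k-1)-simplices; the empty face sits in degree -1. *)

Definition orient_sign (v : V) (s : {set V}) : int :=
  (-1) ^+ #|[set w in s | (enum_rank w < enum_rank v)%N]|.

Definition bdry (c : {set V} -> int) (t : {set V}) : int :=
  \sum_(v in ~: t) orient_sign v (v |: t) * c (v |: t).

Definition is_kchain (K : pred {set V}) (k : nat) (c : {set V} -> int) : Prop :=
  forall s, c s != 0 -> K s /\ #|s| = k.

(* reduced homology \tilde H_{k-1}(K; Z) = 0: every (k-1)-cycle is a boundary *)
Definition rhom_vanish (K : pred {set V}) (k : nat) : Prop :=
  forall c, is_kchain K k c -> (forall t, bdry c t = 0) ->
  exists d, is_kchain K k.+1 d /\ (forall s, c s = bdry d s).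

Definition link (K : pred {set V}) (F : {set V}) : pred {set V} :=
  fun G => [disjoint G & F] && K (G :|: F).

(* Cohen–Macaulay over Z (Reisner): for every face F (incl. the empty one),
   \tilde H_i(lk F; Z) = 0 for all i < dim lk F.  With i = k-1 and
   dim lk F = (max face size) - 1, the condition i < dim lk F reads
   "some face of lk F has more than k vertices". *)
Definition cohen_macaulay_Z (K : pred {set V}) : Prop :=
  forall F, K F -> forall k : nat,
    (exists G, link K F G /\ (k < #|G|)%N) -> rhom_vanish (link K F) k.

Local Open Scope ring_scope.
Definition geom_realization (R : realType) (K : pred {set V}) : set 'rV[R]_#|V| :=
  [set x | (forall i, 0 <= x 0 i) /\ \sum_i x 0 i = 1 /\
           K [set v | x 0 (enum_rank v) != 0]].
End Simplicial.

Local Open Scope ring_scope.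
Definition euclid_ball (R : realType) (d : nat) : set 'rV[R]_d :=
  [set y | \sum_i y 0 i ^+ 2 <= 1].

Local Open Scope classical_set_scope.
Definition homeomorphic (X Y : topologicalType) (A : set X) (B : set Y) : Prop :=
  exists (f : X -> Y) (g : Y -> X),
    [/\ (forall x, A x -> B (f x)), (forall y, B y -> A (g y)),
        (forall x, A x -> g (f x) = x), (forall y, B y -> f (g y) = y)
      & ({within A, continuous f} /\ {within B, continuous g})].

Arguments geom_realization {V} R K.
Arguments euclid_ball R d : clear implicits.
Arguments order_complex_T n s : clear implicits.

(* Main.v *)
Require Import Defs.
From HB Require Import structures.
From mathcomp Require Import all_boot all_order all_algebra.
From mathcomp Require Import ring lra zify.
Set Implicit Arguments. Unset Strict Implicit. Unset Printing Implicit Defensive.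
Import Order.TTheory GRing.Theory Num.Theory.

(** The map [A |-> {(k, j) | A has more than k elements <= j}] identifies the
dual of T_n with the lattice of order ideals of a poset Q, the shifted
staircase without its minimum.

Cohen-Macaulayness: for a chain G of ideals and a natural labelling [om] of Q,
the set of pairs [om q < om q'] for which some ideal in G contains q' but not q
grows with G.  It is the inversion set of the linear extension (facet) obtained
from G by filling each gap in increasing order of labels.  In the link of F,
the G with the same inversion set for G U F form an interval below a facet M,
and are matched by toggling any vertex v of M \ F for which M \ v still has this
inversion set; if there is no such v, then G U F is a facet.  This is the
lexicographic shelling, without its order.

Ball: x |-> (q |-> sum of the x_I over the ideals I containing q) is a
homeomorphism onto the order polytope of Q, whose inverse sends f to
I |-> max(0, min_I f - max_(Q \ I) f).  The order polytope, centred at an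
interior point, is the unit ball of a gauge which is a finite maximum of linear
forms, hence radially homeomorphic to the Euclidean ball.

Number of facets: the number of maximal chains above A satisfies the recursion
over the covers of A, and so does Schur's product formula, by Lagrange
interpolation at the points x(x-1), with x ranging over the parts n - a. *)

(** * Acyclicity from a matching of faces *)

Section Boundary.
Local Open Scope ring_scope.
Variable V : finType.
Implicit Types (c d : {set V} -> int) (s t : {set V}) (v w : V).

Lemma orient_sign_sqr v s : orient_sign v s * orient_sign v s = 1.
Proof. by rewrite /orient_sign -expr2 sqrr_sign. Qed.

Lemma orient_sign_neq0 v s : orient_sign v s != 0.
Proof. by rewrite /orient_sign signr_eq0. Qed.

Lemma orient_signU1 v w s : w \notin s ->
  orient_sign v (w |: s) = (-1) ^+ (enum_rank w < enum_rank v)%N * orient_sign v s.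
Proof.
move=> ws; rewrite /orient_sign -exprD; congr (_ ^+ _).
case: (boolP (_ < _)%N) => [wv|wv] /=.
  transitivity #|w |: [set u in s | (enum_rank u < enum_rank v)%N]|.
    by apply: eq_card => u; rewrite !inE; case: eqP => [->|]//=.
  by rewrite cardsU1 inE (negbTE ws).
rewrite add0n; apply: eq_card => u; rewrite !inE.
by case: eqP => [->|]//=; rewrite (negbTE wv) andbF.
Qed.

Lemma bdry_bdry c t : bdry (bdry c) t = 0.
Proof.
rewrite /bdry.
(* Extended by zero to all pairs of vertices, the terms change sign when the two vertices are
   exchanged, so their sum is its own negative. *)
pose A v w := if (v \notin t) && (w \notin t) && (v != w) then
  orient_sign v (v |: t) * (orient_sign w (w |: (v |: t)) * c (w |: (v |: t))) else 0.
have -> : \sum_(v in ~: t) orient_sign v (v |: t) *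
   (\sum_(w in ~: (v |: t)) orient_sign w (w |: (v |: t)) * c (w |: (v |: t)))
   = \sum_v \sum_w A v w.
  rewrite [LHS]big_mkcond; apply: eq_bigr => v _; rewrite inE.
  case: (boolP (v \in t)) => vt /=.
    by rewrite big1 // => w _; rewrite /A vt.
  rewrite mulr_sumr big_mkcond; apply: eq_bigr => w _.
  rewrite !inE negb_or /A vt /= eq_sym andbC; by case: ifP.
have AN v w : A w v = - A v w.
  rewrite /A eq_sym [(w \notin t) && _]andbC; case: ifP; last by rewrite oppr0.
  case/andP=> /andP[vt wt] vw.
  have vwt : v \notin w |: t by rewrite !inE (negbTE vt) (negbTE vw).
  have wvt : w \notin v |: t by rewrite !inE (negbTE wt) eq_sym (negbTE vw).
  have uE : v |: (w |: t) = w |: (v |: t) by rewrite setUCA.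
  have Ew : orient_sign w (w |: (v |: t)) =
      (-1) ^+ (enum_rank v < enum_rank w)%N * orient_sign w (w |: t).
    by rewrite -uE orient_signU1.
  have Ev : orient_sign v (w |: (v |: t)) =
      (-1) ^+ (enum_rank w < enum_rank v)%N * orient_sign v (v |: t).
    by rewrite orient_signU1.
  rewrite uE Ew Ev !mulrA -mulNr; congr (_ * _).
  have : enum_rank v != enum_rank w by rewrite (inj_eq enum_rank_inj).
  rewrite -val_eqE neq_ltn => /orP[] h; rewrite h ltnNge (ltnW h) /=; ring.
have S : \sum_v \sum_w A v w = - \sum_v \sum_w A v w.
  rewrite {1}exchange_big -sumrN; apply: eq_bigr => v _.
  by rewrite -sumrN; apply: eq_bigr => w _; rewrite AN.
have neg0 (x : int) : x = - x -> x = 0 by lra.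
exact: neg0 S.
Qed.

Lemma bdryD c d t : bdry (fun s => c s + d s) t = bdry c t + bdry d t.
Proof. by rewrite /bdry -big_split; apply: eq_bigr => v _; rewrite mulrDr. Qed.

Lemma bdryN c t : bdry (fun s => - c s) t = - bdry c t.
Proof. by rewrite /bdry -sumrN; apply: eq_bigr => v _; rewrite mulrN. Qed.

Lemma bdry_neq0 c t : bdry c t != 0 -> exists2 v, v \notin t & c (v |: t) != 0.
Proof.
move=> h; apply/exists_inP; apply: contraNT h; rewrite negb_exists_in => /forall_inP h.
rewrite /bdry big1 // => v; rewrite inE => /h; rewrite negbK => /eqP ->.
by rewrite mulr0.
Qed.

Variables (T : finType) (cl : {set V} -> {set T}) (K : pred {set V}) (k : nat).
Hypothesis Kdown : forall G H : {set V}, G \subset H -> K H -> K G.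
Hypothesis cl_mono : forall G H : {set V}, G \subset H -> cl G \subset cl H.
(** One vertex has to serve the whole class of [G]. Larger faces are exempt because only cycles on
    [k]-vertex faces have to be bounded. *)
Hypothesis cl_match : forall G, K G -> (k < #|G|)%N \/ exists v,
  forall H, K H -> cl H = cl G ->
    [/\ K (v |: H), cl (v |: H) = cl G & cl (H :\ v) = cl G].

Let cl_eq (G H : {set V}) : G \subset H -> (#|cl H| <= #|cl G|)%N -> cl G = cl H.
Proof. by move=> /cl_mono GH le; apply/eqP; rewrite eqEcard GH. Qed.

Let good S v := [forall H : {set V}, K H ==> (cl H == S) ==>
  [&& K (v |: H), cl (v |: H) == S & cl (H :\ v) == S]].

Let goodP S v H : good S v -> K H -> cl H = S ->
  [/\ K (v |: H), cl (v |: H) = S & cl (H :\ v) = S].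
Proof.
move/forallP/(_ H)/implyP => h /h /implyP h' /eqP/h'.
by case/and3P=> ? /eqP ? /eqP ?.
Qed.

Let pv S : option V := [pick v | good S v].

Let pvP G : K G -> #|G| = k -> exists2 v, pv (cl G) = Some v & good (cl G) v.
Proof.
move=> KG Gk; case: (cl_match KG) => [|[v hv]]; first by rewrite Gk ltnn.
rewrite /pv; case: pickP => [v' hv'|/(_ v)]; first by exists v'.
move/negP; case; apply/forallP => H; apply/implyP => KH; apply/implyP => /eqP e.
by have [-> -> ->] := hv H KH e; rewrite !eqxx.
Qed.

(* Within each class the faces are matched by toggling the vertex [v] of
   [cl_match]; a cycle is pushed by boundaries from the classes of largest
   cardinality into smaller ones. *)
Lemma matching_rhom_vanish : rhom_vanish K k.
Proof.
suff main N c : (forall s, c s != 0 -> [/\ K s, #|s| = k & (#|cl s| < N)%N]) ->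
    (forall t, bdry c t = 0) ->
    exists d, is_kchain K k.+1 d /\ (forall s, c s = bdry d s).
  move=> c hc bc; apply: (main #|T|.+1) => // s /hc[? ?].
  by rewrite ltnS max_card.
elim: N c => [|N IH] c hc bc.
  exists (fun=> 0); split=> [s|s]; first by rewrite eqxx.
  rewrite /bdry big1 => [|v _]; last by rewrite mulr0.
  by apply/eqP; apply/negPn/negP => /hc[].
(* A cone over the part of [c] in the classes of size [N], with the toggled vertex as apex; the sign
   makes [bdry d] equal [c] at the [k]-vertex faces of these classes that avoid the apex. *)
pose d s := if K s && (#|cl s| == N) then
    if pv (cl s) is Some v then
      if v \in s then orient_sign v s * c (s :\ v) else 0 else 0 else 0.
have dP s : d s != 0 -> exists v, [/\ K s, #|cl s| = N, pv (cl s) = Some v,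
    v \in s & c (s :\ v) != 0].
  rewrite /d; case: ifP; last by rewrite eqxx.
  case/andP=> Ks /eqP sN; case E: pv => [v|]; last by rewrite eqxx.
  case: ifP; last by rewrite eqxx.
  by move=> vs; rewrite mulf_eq0 negb_or => /andP[_ h]; exists v.
have dk : is_kchain K k.+1 d.
  move=> s /dP[v [Ks _ _ vs /hc[_ h _]]]; split => //.
  by rewrite (cardsD1 v) vs h.
pose c' s := c s - bdry d s.
have bc' t : bdry c' t = 0.
  by rewrite /c' bdryD bdryN bdry_bdry bc subrr.
have c'supp s : c' s != 0 -> [/\ K s, #|s| = k & (#|cl s| <= N)%N].
  rewrite /c'; case: (eqVneq (c s) 0) => [->|/hc[? ?]]; last by rewrite ltnS.
  rewrite sub0r oppr_eq0 => /bdry_neq0[w ws dw].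
  have [Kws h] := dk _ dw; have [v [_ <- _ _ _]] := dP _ dw.
  split; [exact: Kdown (subsetUr _ _) Kws| |exact/subset_leq_card/cl_mono/subsetUr].
  by move: h; rewrite cardsU1 ws => -[].
(* Any other term [w |: s] of [bdry d s] would by [cl_eq] lie in the class of [s], hence contain the
   apex [v], which is neither [w] nor in [s]. *)
have c'0 s v : K s -> #|cl s| = N -> #|s| = k -> pv (cl s) = Some v ->
   v \notin s -> c' s = 0.
  move=> Ks sN sk pvs vs; have [v' ] := pvP Ks sk; rewrite pvs => -[<-] gv.
  have [Kv clv _] := goodP gv Ks erefl.
  rewrite /c' /bdry (bigD1 v) ?inE //= big1 ?addr0.
    rewrite /d Kv clv sN eqxx /= pvs setU11 setU1K // mulrA orient_sign_sqr.
    by rewrite mul1r subrr.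
  move=> w; rewrite inE => /andP[ws wv].
  have [->|/dP[u [Kw clw pvw uw cw]]] := eqVneq (d (w |: s)) 0; first by rewrite mulr0.
  have e : cl s = cl (w |: s).
    by apply: cl_eq (subsetUr _ _) _; rewrite clw sN.
  move: pvw; rewrite -e pvs => -[uE]; move: uw.
  by rewrite -uE !inE (negbTE vs) orbF eq_sym (negbTE wv).
have [s|t|d' [d'k d'E]] := IH c'; [|exact: bc'|].
- move=> cs; have [Ks sk sN] := c'supp _ cs; split => //.
  rewrite ltn_neqAle sN andbT; apply/eqP => {}sN.
  have [v pvs gv] := pvP Ks sk.
  have [_ _ clv] := goodP gv Ks erefl.
  have [vs|vs] := boolP (v \in s); last first.
    by rewrite (c'0 s v) ?eqxx in cs.
  (* In the cycle condition at [s :\ v], every term other than [s] belongs to a face that avoids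
     [v], and [c'0] removes it. *)
  have : bdry c' (s :\ v) = 0 by [].
  rewrite /bdry (bigD1 v) ?inE ?eqxx //= setD1K // big1 ?addr0.
    by move/eqP; rewrite mulf_eq0 (negbTE cs) orbF (negbTE (orient_sign_neq0 _ _)).
  move=> w; rewrite !inE negb_and negbK => /andP[/orP[/eqP ->|ws] wv].
    by rewrite eqxx in wv.
  have [->|cw] := eqVneq (c' (w |: s :\ v)) 0; first by rewrite mulr0.
  have [Kw wk wN] := c'supp _ cw.
  have e : cl (s :\ v) = cl (w |: s :\ v).
    by apply: cl_eq (subsetUr _ _) _; rewrite clv sN.
  rewrite (c'0 _ v) ?mulr0 // -?e ?clv //.
  by rewrite !inE eqxx eq_sym (negbTE wv).
- exists (fun s => d s + d' s); split.
    move=> s; have [->|/dk//] := eqVneq (d s) 0.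
    by rewrite add0r => /d'k.
  by move=> s; rewrite bdryD -d'E /c' addrC subrK.
Qed.

End Boundary.

(** * Order complexes of ideal lattices *)

Section IdealLattice.
Variables (V Q : finType) (D : pred V) (I : V -> {set Q}).
Variables (low : rel Q) (om : Q -> nat).

Definition chain_complex (s : {set V}) : bool :=
  [forall a in s, D a] &&
  [forall a in s, forall b in s, (I b \subset I a) || (I a \subset I b)].

Definition low_closed (S : {set Q}) : Prop :=
  forall q q', low q q' -> q' \in S -> q \in S.

(* [D] selects the vertices of a finite type that are used; [om] is a natural
   labelling of the poset generated by [low], and [I] identifies the vertices
   with the order ideals of that poset. *)
Record ideal_model : Prop := IdealModel {
  om_inj : injective om;
  low_om : forall q q', low q q' -> (om q < om q')%N;
  I_inj : {in D &, injective I};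
  I_closed : forall v, D v -> low_closed (I v);
  I_surj : forall S, low_closed S -> exists2 v, D v & I v = S }.

Hypothesis HI : ideal_model.
Implicit Types (G H M : {set V}) (x u v : V) (q r : Q) (S : {set Q * Q}).

Lemma chain_complexP G : reflect
  ((forall v, v \in G -> D v) /\
   (forall u v, u \in G -> v \in G -> I u \subset I v \/ I v \subset I u))
  (chain_complex G).
Proof.
apply: (iffP andP) => -[h1 h2].
  split=> [v|u v uG vG]; first by move/forall_inP: h1; apply.
  move/forall_inP: h2 => /(_ _ vG) /forall_inP/(_ _ uG)/orP[]; by [left|right].
split; apply/forall_inP => a aG; first exact: h1.
by apply/forall_inP => b bG; apply/orP/(h2 b a).
Qed.

Lemma chain_complexS G H : G \subset H -> chain_complex H -> chain_complex G.
Proof.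
move=> /subsetP GH /chain_complexP[h1 h2]; apply/chain_complexP.
by split=> [v /GH/h1|u v /GH uH /GH vH] //; apply: h2.
Qed.

Definition separates G q q' := [exists x in G, (q \in I x) && (q' \notin I x)].

Definition inversions G : {set Q * Q} :=
  [set p : Q * Q | (om p.1 < om p.2)%N && separates G p.2 p.1].

(* The linear extension with inversion set [S]. *)
Definition prec S q q' :=
  if (om q < om q')%N then (q, q') \notin S else
  (om q' < om q)%N && ((q', q) \in S).

(** The initial segments of [prec S]. *)
Definition facet S : {set V} :=
  [set x | D x & [forall q in I x, forall q' in ~: I x, prec S q q']].

Lemma facetP S x : reflect
  (D x /\ forall q q', q \in I x -> q' \notin I x -> prec S q q') (x \in facet S).
Proof.
rewrite inE; apply: (iffP andP) => -[Dx h]; split=> //.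
  move=> q q' qx q'x.
  by move/forall_inP: h => /(_ _ qx)/forall_inP; apply; rewrite inE.
apply/forall_inP => q qx; apply/forall_inP => q'; rewrite inE; exact: h.
Qed.

Lemma separatesP G q q' :
  reflect (exists x, [/\ x \in G, q \in I x & q' \notin I x]) (separates G q q').
Proof.
apply: (iffP exists_inP) => [[x xG /andP[]]|[x [xG h1 h2]]]; exists x => //.
by rewrite h1.
Qed.

Lemma separatesS G H q q' : G \subset H -> separates G q q' -> separates H q q'.
Proof.
by move=> /subsetP GH /separatesP[x [/GH xH ? ?]]; apply/separatesP; exists x.
Qed.

Lemma inversionsS G H : G \subset H -> inversions G \subset inversions H.
Proof.
move=> GH; apply/subsetP => -[q q']; rewrite !inE /= => /andP[-> ].
exact: separatesS.
Qed.

(** Lexicographic: first the gap of the chain in which [q] enters, measured by the number of members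
    of [G] that miss [q], then the label. This order is the linear extension that fills each gap by
    increasing labels. *)
Let key G q := (#|[set x in G | q \notin I x]| * (\max_q om q).+1 + om q)%N.

Let om_lt q : (om q < (\max_q om q).+1)%N.
Proof. by rewrite ltnS leq_bigmax. Qed.

Let key_sep G q q' : chain_complex G -> separates G q q' -> (key G q < key G q')%N.
Proof.
move=> /chain_complexP[_ ch] /separatesP[x [xG qx q'x]].
have : (#|[set x in G | q \notin I x]| < #|[set x in G | q' \notin I x]|)%N.
  apply/proper_card/properP; split; last by exists x; rewrite !inE xG ?q'x ?qx.
  apply/subsetP => y; rewrite !inE => /andP[yG qy]; rewrite yG /=.
  case: (ch _ _ xG yG) => /subsetP; first by move/(_ _ qx); rewrite (negbTE qy).
  by move=> yx; apply: contra q'x => /yx.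
rewrite /key; have := om_lt q; nia.
Qed.

Let key_nsep G q q' : ~~ separates G q q' -> ~~ separates G q' q ->
  (key G q < key G q')%N = (om q < om q')%N.
Proof.
move=> n1 n2; rewrite /key; suff -> : [set x in G | q \notin I x] = [set x in G | q' \notin I x].
  by rewrite ltn_add2l.
apply/setP => x; rewrite !inE; case: (boolP (x \in G)) => //= xG; congr (~~ _).
apply/idP/idP => qx; apply/negPn/negP => q'x.
  by case/separatesP: n1; exists x.
by case/separatesP: n2; exists x.
Qed.

Let precE G q q' : chain_complex G -> prec (inversions G) q q' = (key G q < key G q')%N.
Proof.
move=> ch; rewrite /prec !inE /=.
have [s1|s1] := boolP (separates G q q').
  have k1 := key_sep ch s1; rewrite k1.
  have -> : separates G q' q = false.
    by apply/negbTE/negP => s2; have := key_sep ch s2; rewrite ltnNge (ltnW k1).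
  rewrite andbF /= andbT; case: ltngtP => // /(om_inj HI) e; move: k1.
  by rewrite e ltnn.
have [s2|s2] := boolP (separates G q' q).
  have -> : (key G q < key G q')%N = false by rewrite ltnNge (ltnW (key_sep ch s2)).
  by rewrite andbF /= andbT; case: ltngtP.
by rewrite !andbF /= (key_nsep s1 s2); case: ltngtP.
Qed.

Lemma sub_facet G : chain_complex G -> G \subset facet (inversions G).
Proof.
move=> ch; apply/subsetP => x xG; apply/facetP; split.
  by case/chain_complexP: ch => h _; apply: h.
move=> q q' qx q'x; rewrite precE //; apply: key_sep => //.
by apply/separatesP; exists x.
Qed.

Lemma facet_chain G : chain_complex G -> chain_complex (facet (inversions G)).
Proof.
move=> ch; apply/chain_complexP; split=> [v /facetP[]//|u v /facetP[_ hu] /facetP[_ hv]].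
apply/orP; rewrite -[_ || _]negbK negb_or; apply/negP => /andP[].
case/subsetPn => q qu qv; case/subsetPn => q' q'v q'u.
have := hu _ _ qu q'u; have := hv _ _ q'v qv; rewrite !precE //.
by case: ltngtP.
Qed.

Lemma inversions_facet G : chain_complex G ->
  inversions (facet (inversions G)) = inversions G.
Proof.
move=> ch; apply/eqP; rewrite eqEsubset; apply/andP; split; last first.
  exact/inversionsS/sub_facet.
apply/subsetP => -[q q']; rewrite inE /= => /andP[lt].
case/separatesP=> x [/facetP[_ h] qx q'x]; have := h _ _ qx q'x.
by rewrite /prec ltnNge (ltnW lt) lt.
Qed.

Lemma free_vertex_toggle S v G :
  chain_complex (facet S) -> v \in facet S -> inversions (facet S) = S ->
  inversions (facet S :\ v) = S -> chain_complex G -> inversions G = S ->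
  inversions (G :\ v) = S.
Proof.
move=> chM vM MS MvS chG GS; apply/eqP; rewrite eqEsubset; apply/andP; split.
  by rewrite -[X in _ \subset pred_of_set X]GS inversionsS ?subsetDl.
have GM : G \subset facet S by rewrite -GS sub_facet.
have pk a b : prec S a b = (key G a < key G b)%N by rewrite -GS precE.
apply/subsetP => -[q1 q2] inS.
have : (q1, q2) \in inversions G by rewrite GS.
rewrite inE /= => /andP[lt12 /separatesP[u0 [u0G q2u q1u]]].
rewrite inE /= lt12 /=.
have [u0v|u0v] := eqVneq u0 v; last first.
  by apply/separatesP; exists u0; rewrite !inE u0v.
subst u0; have [_ vinit] := facetP _ _ vM.
have q2v : (fun q => q \in I v) q2 by [].
have q1v : (fun q => q \notin I v) q1 by [].
case: (@arg_maxnP _ q2 (fun q => q \in I v) (key G) q2v) => r rv rmax0.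
have {rmax0} rmax j : j \in I v -> (key G j <= key G r)%N by exact: rmax0.
case: (@arg_minnP _ q1 (fun q => q \notin I v) (key G) q1v) => r' r'v rmin.
(* Otherwise [(r', r)] is an inversion, and a member [u] of the facet other than [v] contains [r]
   but not [r']; as an initial segment it equals [I v]. *)
have rr' : (om r < om r')%N.
  have := vinit _ _ rv r'v; rewrite /prec; case: ifP => // _ /andP[_ ].
  rewrite -MvS inE /= => /andP[_ /separatesP[u [uMv ru r'u]]]; exfalso.
  have [uv uM] := setD1P uMv.
  have [Du uinit] := facetP _ _ uM.
  have [Dv _] := facetP _ _ vM.
  move/eqP: uv; apply; apply: (I_inj HI) => //; apply/setP => y; apply/idP/idP => yu.
    apply/negPn/negP => yv; have := uinit _ _ yu r'u; rewrite pk.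
    by rewrite ltnNge rmin.
  apply/negPn/negP => yv; have := uinit _ _ ru yv; rewrite pk.
  by rewrite ltnNge rmax.
(* Here [r] comes after [q2] with a smaller label, so some [u] in [G] contains [q2] and misses [r].
   It is not [v], and it misses [q1], which comes after [r]. The next case is dual, with [r'] for
   [r]. *)
have [lt1|le1] := ltnP (om r) (om q2).
  have : (r, q2) \in inversions G.
    rewrite GS; apply: contraT => nS.
    have : prec S r q2 by rewrite /prec lt1.
    by rewrite pk ltnNge rmax.
  rewrite inE => /andP[_ /separatesP[u [uG q2u' ru]]].
  apply/separatesP; exists u; split => //; rewrite ?inE ?uG ?andbT.
    by apply: contraNneq ru => ->.
  have [_ uinit] := facetP _ _ (subsetP GM _ uG).
  apply: contra ru => q1u'; apply/negPn/negP => ru.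
  have := uinit _ _ q1u' ru; rewrite pk; have := vinit _ _ rv q1u.
  by rewrite pk; case: ltngtP.
have [lt2|le2] := ltnP (om q1) (om r').
  have : (q1, r') \in inversions G.
    rewrite GS; apply: contraT => nS.
    have : prec S q1 r' by rewrite /prec lt2.
    by rewrite pk ltnNge rmin.
  rewrite inE => /andP[_ /separatesP[u [uG r'u q1u']]].
  apply/separatesP; exists u; split => //; rewrite ?inE ?uG ?andbT.
    by apply: contraNneq r'v => <-.
  have [_ uinit] := facetP _ _ (subsetP GM _ uG).
  apply/negPn/negP => q2u'.
  have := uinit _ _ r'u q2u'; rewrite pk; have := vinit _ _ q2u r'v.
  by rewrite pk; case: ltngtP.
(* What remains is [om q2 <= om r < om r' <= om q1], against [om q1 < om q2]. *)
by move: (leq_trans lt12 (leq_trans le1 (ltnW rr'))); rewrite ltnNge le2.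
Qed.

Lemma card_chain_le m G : chain_complex G ->
  (forall v, v \in G -> (#|I v| <= m)%N) -> (#|G| <= m.+1)%N.
Proof.
move=> /chain_complexP[hD ch] hm.
pose f v : 'I_m.+1 := inord #|I v|.
rewrite -(card_in_imset (f := f)); first by rewrite -[X in (_ <= X)%N]card_ord max_card.
move=> u v uG vG /(congr1 val); rewrite /= !inordK ?ltnS ?hm // => e.
apply: (I_inj HI); [exact: hD..|].
case: (ch _ _ uG vG) => s; apply/eqP; first by rewrite eqEcard s e leqnn.
by rewrite eq_sym eqEcard s e leqnn.
Qed.

Lemma card_chain G : chain_complex G -> (#|G| <= #|Q|.+1)%N.
Proof. by move=> /card_chain_le; apply=> v _; apply: max_card. Qed.

(** The order [prec (inversions G)] is total and extends [low], so each of its [#|Q|.+1] initial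
    segments is an ideal and gives a vertex of the facet. *)
Lemma card_facet G : chain_complex G -> (#|Q| < #|facet (inversions G)|)%N.
Proof.
move=> ch; pose key' := key G.
have key_inj : injective key'.
  move=> q q' e; apply: (om_inj HI); apply/eqP.
  have := precE q q' ch; have := precE q' q ch; rewrite /key' in e.
  rewrite e ltnn /prec; case: ltngtP => //= _; by case: (_ \in _).
pose seg (k : 'I_#|Q|.+1) := [set q | (#|[set q' | (key' q' < key' q)%N]| < k)%N].
have segD k q q' : (key' q' <= key' q)%N -> q \in seg k -> q' \in seg k.
  rewrite !inE => le; apply: leq_ltn_trans; apply/subset_leq_card/subsetP => y.
  by rewrite !inE => /leq_trans; apply.
have segC k : low_closed (seg k).
  move=> q q' /[dup] lo /(low_om HI) lt; apply: segD.
  have : prec (inversions G) q q'.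
    rewrite /prec lt inE lt /=; apply/negP => /separatesP[x [xG q'x qx]].
    case/chain_complexP: ch => hD _; move: qx.
    by rewrite (I_closed HI (hD _ xG) lo).
  by rewrite precE // => /ltnW.
have [vtx vtxP] : exists vtx : 'I_#|Q|.+1 -> V, forall k, D (vtx k) /\ I (vtx k) = seg k.
  have h k : exists v, D v && (I v == seg k).
    by have [v Dv Iv] := I_surj HI (@segC k); exists v; rewrite Dv Iv eqxx.
  by exists (fun k => xchoose (h k)) => k; case/andP: (xchooseP (h k)) => ? /eqP.
have vtxF k : vtx k \in facet (inversions G).
  have [Dv Iv] := vtxP k; apply/facetP; split => // q q'; rewrite Iv => qs q's.
  by rewrite precE // ltnNge; apply: contra q's => le; apply: segD qs.
rewrite -[X in (X <= _)%N]card_ord -(card_imset _ (f := vtx)).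
  by apply/subset_leq_card/subsetP => _ /imsetP[k _ ->].
(* Ranks run bijectively through the numbers below [#|Q|]; for [k < k'] the element of rank [k]
   distinguishes [seg k] from [seg k']. *)
pose rk q := #|[set q' | (key' q' < key' q)%N]|.
have rk_lt q : (rk q < #|Q|)%N.
  rewrite -cardsT; apply/proper_card/properP; split; first exact: subsetT.
  by exists q; rewrite ?inE ?ltnn.
have rk_mono q q' : (key' q < key' q')%N -> (rk q < rk q')%N.
  move=> lt; apply/proper_card/properP; split; last by exists q; rewrite !inE ?ltnn.
  by apply/subsetP => y; rewrite !inE => /ltn_trans; apply.
have /inj_card_bij[] : injective (fun q => Ordinal (rk_lt q)).
- move=> q q' /(congr1 val) /= e; apply: key_inj; apply/eqP.
  by case: ltngtP => // /rk_mono; rewrite e ltnn.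
- by rewrite card_ord.
move=> rkV _ rkK k k'.
wlog suff W : k k' / (k < k')%N -> vtx k <> vtx k'.
  by move=> e; apply: val_inj; apply/eqP; case: ltngtP => // /W; rewrite e.
move=> lt e; have ltQ : (k < #|Q|)%N by rewrite (leq_trans lt) // -ltnS ltn_ord.
have rkq : rk (rkV (Ordinal ltQ)) = k by have := congr1 val (rkK (Ordinal ltQ)).
have : rkV (Ordinal ltQ) \in seg k' by rewrite inE -/(rk _) rkq.
by rewrite -(proj2 (vtxP k')) -e (proj2 (vtxP k)) inE -/(rk _) rkq ltnn.
Qed.

Lemma chain_maximal_card G :
  maxset chain_complex G = chain_complex G && (#|G| == #|Q|.+1).
Proof.
apply/maxsetP/andP => [[ch mx]|[ch /eqP cG]].
  split=> //; rewrite -(mx _ (facet_chain ch) (sub_facet ch)).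
  by rewrite eqn_leq card_facet // card_chain ?facet_chain.
split=> // H chH GH; apply/eqP; rewrite eq_sym eqEcard GH cG.
exact: card_chain.
Qed.

Lemma chain_complex_CM : cohen_macaulay_Z chain_complex.
Proof.
move=> F chF k [G0 [/andP[dis0 ch0] k0]].
apply: (@matching_rhom_vanish _ _ (fun G => inversions (G :|: F))).
- move=> G H GH /andP[dH chH]; apply/andP; split; last exact: chain_complexS (setSU _ GH) chH.
  exact: disjointWl dH.
- by move=> G H GH; apply: inversionsS; apply: setSU.
- move=> G /andP[dG chG]; set S := inversions (G :|: F).
  have [/exists_inP[v vM /andP[vF /eqP MvS]]|no] := boolP [exists v in facet S,
      (v \notin F) && (inversions (facet S :\ v) == S)].
    right; exists v => H /andP[dH chH] HS.
    have chM : chain_complex (facet S) by exact: facet_chain.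
    have MS : inversions (facet S) = S by exact: inversions_facet.
    have HM : H :|: F \subset facet S by rewrite -HS sub_facet.
    have vHM : v |: (H :|: F) \subset facet S by rewrite subUset sub1set vM.
    split.
    + rewrite /link -setUA (chain_complexS vHM) // andbT.
      by rewrite disjoints_subset subUset sub1set inE vF -disjoints_subset.
    + apply/eqP; rewrite -setUA eqEsubset; apply/andP; split.
        by rewrite -[X in _ \subset pred_of_set X]MS inversionsS.
      by rewrite -[X in pred_of_set X \subset _]HS inversionsS ?subsetUr.
    + have -> : H :\ v :|: F = (H :|: F) :\ v.
        by rewrite setDUl [F :\ v](setDidPl _) // disjoint_sym disjoints1.
      exact: (free_vertex_toggle chM vM MS MvS).
  (* A vertex of the facet outside [G :|: F] could be dropped without losing inversions, so here
     [G :|: F] is the facet. Hence [G] is at least as large as the face [G0] of the link, which has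
     more than [k] vertices. *)
  left; apply: leq_trans k0 _.
  have GF : G :|: F = facet S.
    apply/eqP; rewrite eqEsubset sub_facet //=; apply/subsetP => v vM.
    apply: contraR no => vGF; apply/exists_inP; exists v => //; apply/andP; split.
      by apply: contra vGF => vF; rewrite inE vF orbT.
    have sub : G :|: F \subset facet S :\ v.
      by rewrite subsetD1 sub_facet.
    rewrite eqEsubset; apply/andP; split.
      by rewrite -[X in _ \subset pred_of_set X](inversions_facet chG) inversionsS ?subsetDl.
    exact: inversionsS.
  have cG0 := card_chain ch0; have cG := card_facet chG.
  have cU (A : {set V}) : [disjoint A & F] -> #|A :|: F| = (#|A| + #|F|)%N.
    by move=> dA; rewrite cardsU (disjoint_setI0 dA) cards0 subn0.
  rewrite -/S -GF (cU _ dG) in cG; rewrite (cU _ dis0) in cG0.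
  by rewrite -(leq_add2r #|F|) (leq_trans cG0).
Qed.

(** * Recursion for the number of maximal chains below a vertex *)

Definition max_chains_from x : {set {set V}} :=
  [set s | [&& chain_complex s, x \in s, [forall y in s, I y \subset I x] &
    #|s| == #|I x|.+1]].

Definition covered x y := [&& D y, I y \subset I x & #|I x| == #|I y|.+1].

Lemma max_chains_fromP x s : reflect
  [/\ chain_complex s, x \in s, forall y, y \in s -> I y \subset I x & #|s| = #|I x|.+1]
  (s \in max_chains_from x).
Proof.
rewrite inE; apply: (iffP and4P) => -[h1 h2 h3 h4]; split => //.
- by move/forall_inP: h3.
- exact/eqP.
- exact/forall_inP.
- exact/eqP.
Qed.

Lemma card_max_chains_from0 x : D x -> #|I x| = 0%N -> #|max_chains_from x| = 1%N.
Proof.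
move=> Dx Ix0; rewrite (_ : max_chains_from x = [set [set x]]) ?cards1 //.
apply/setP => s; apply/max_chains_fromP/set1P => [[_ xs _ cs]|->].
  by apply/eqP; rewrite eq_sym eqEcard sub1set xs cs Ix0 cards1.
split; rewrite ?set11 ?cards1 ?Ix0 //; last by move=> y /set1P ->.
by apply/chain_complexP; split=> [v|u v] /set1P ->; last by move=> /set1P ->; left.
Qed.

(** The largest remaining member [y] works: the [#|I x|] ideals in [s :\ x] have distinct
    cardinalities between 0 and [#|I y|]. *)
Lemma max_chains_fromD1 x s : (0 < #|I x|)%N -> s \in max_chains_from x ->
  exists2 y, covered x y & s :\ x \in max_chains_from y.
Proof.
move=> Ix0 /max_chains_fromP[ch xs sx cs].
have cs' : #|s :\ x| = #|I x| by move: cs; rewrite (cardsD1 x s) xs => -[].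
have [y0 y0s] : exists y, y \in s :\ x by apply/card_gt0P; rewrite cs'.
case: (@arg_maxnP _ y0 (fun y => y \in s :\ x) (fun y => #|I y|) y0s) => y ysx ymax.
have ch' : chain_complex (s :\ x) by apply: chain_complexS ch; apply: subsetDl.
have [hD hc] := chain_complexP _ ch.
have [yx ys] := setD1P ysx.
have le : (#|I x| <= #|I y|.+1)%N by rewrite -cs'; apply: card_chain_le.
have lt : (#|I y| < #|I x|)%N.
  apply/proper_card; rewrite properEneq sx // andbT; apply/eqP => e.
  by move/eqP: yx; apply; apply: (I_inj HI) => //; apply: hD.
exists y.
  by apply/and3P; split; [exact: hD|exact: sx|rewrite eqn_leq le lt].
apply/max_chains_fromP; split => //; last by rewrite cs'; apply/eqP; rewrite eqn_leq le lt.
move=> z zsx; have [_ zs] := setD1P zsx.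
case: (hc _ _ ys zs) => // yz.
by rewrite -(eqP (_ : I y == I z)) // eqEcard yz; apply: ymax.
Qed.

Lemma max_chains_fromU1 x y t : D x -> covered x y -> t \in max_chains_from y ->
  x \notin t /\ x |: t \in max_chains_from x.
Proof.
move=> Dx /and3P[Dy yx /eqP cxy] /max_chains_fromP[ch yt ty ct].
have xt : x \notin t.
  by apply/negP => /ty/subset_leq_card; rewrite cxy ltnn.
have tx z : z \in x |: t -> I z \subset I x.
  by case/setU1P => [->//|/ty zy]; apply: subset_trans zy yx.
split=> //; apply/max_chains_fromP; split => //; first 2 last.
- by rewrite cardsU1 xt ct cxy.
- have [hD hc] := chain_complexP _ ch; apply/chain_complexP; split.
    by move=> v /setU1P[->|/hD].
  move=> u v uxt vxt; case/setU1P: (uxt) => [->|ut]; first by right; apply: tx.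
  by case/setU1P: (vxt) => [->|vt]; [left; apply: tx|apply: hc].
- exact: setU11.
Qed.

(** A chain without its top [x] determines [y] as its new top; adding [x] back is the inverse for
    each [y]. *)
Lemma card_max_chains_from x : D x -> (0 < #|I x|)%N ->
  #|max_chains_from x| = (\sum_(y | covered x y) #|max_chains_from y|)%N.
Proof.
move=> Dx Ix0.
transitivity (\sum_(s in max_chains_from x)
    \sum_(y | covered x y) (s :\ x \in max_chains_from y : nat))%N.
  rewrite -sum1_card; apply: eq_bigr => s sx.
  have [y cy sy] := max_chains_fromD1 Ix0 sx.
  rewrite (bigD1 y) //= sy big1 // => z /andP[cz zy].
  apply/eqP; rewrite eqb0; apply: contra zy => sz; apply/eqP.
  have [_ ys ly _] := max_chains_fromP _ _ sy; have [_ zs lz _] := max_chains_fromP _ _ sz.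
  case/and3P: cy cz => Dy _ _ /and3P[Dz _ _].
  by apply: (I_inj HI) => //; apply/eqP; rewrite eqEsubset ly // lz.
rewrite exchange_big; apply: eq_bigr => y cy.
rewrite -(card_in_imset (f := fun t => x |: t)) => [|t t' tT t'T e]; last first.
  have [xt _] := max_chains_fromU1 Dx cy tT; have [xt' _] := max_chains_fromU1 Dx cy t'T.
  by rewrite -(setU1K xt) e setU1K.
rewrite -sum1_card big_mkcond [RHS]big_mkcond; apply: eq_bigr => s _.
case: imsetP => [[t ty ->]|no].
  by have [xt ->] := max_chains_fromU1 Dx cy ty; rewrite setU1K // ty.
case: ifP => // sx; case: (boolP (_ \in _)) => // sy; case: no; exists (s :\ x) => //.
by have [_ xs _ _] := max_chains_fromP _ _ sx; rewrite setD1K.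
Qed.

Lemma card_maxset_chains x : D x -> I x = setT ->
  #|[set s | maxset chain_complex s]| = #|max_chains_from x|.
Proof.
move=> Dx IxT; apply: eq_card => s; rewrite inE chain_maximal_card.
apply/andP/max_chains_fromP => [[ch /eqP cs]|[ch _ _ ->]]; last by rewrite IxT cardsT.
split=> // [||]; last by rewrite IxT cardsT.
  have : maxset chain_complex s by rewrite chain_maximal_card ch cs eqxx.
  case/maxsetP => _ mx; rewrite -(mx (x |: s)) ?setU11 ?subsetUr //.
  have [hD hc] := chain_complexP _ ch; apply/chain_complexP; split.
    by move=> v /setU1P[->|/hD].
  move=> u v /setU1P[->|us] /setU1P[->|vs]; rewrite ?IxT ?subsetT; auto.
by move=> y _; rewrite IxT subsetT.
Qed.

End IdealLattice.

(** * The tableau order as a lattice of ideals *)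

Lemma sorted_nth_lt (s : seq nat) j k : sorted leq s -> (k < size s)%N ->
  (nth 0%N s k < j)%N = (k < count (fun x => x < j)%N s)%N.
Proof.
elim: s k => [|x s IH] k //= ps; have {}IH := IH _ (path_sorted ps).
have [xj|jx] := ltnP x j; first by case: k => [|k] //=; rewrite add1n !ltnS; apply: IH.
move=> ks; have all_ge : all (fun y => j <= y)%N (x :: s).
  rewrite /= jx; apply/allP => y ys; apply: leq_trans jx _.
  by have /allP := order_path_min leq_trans ps; apply.
have -> : count (fun x => x < j)%N s = 0%N.
  apply/eqP; rewrite -leqn0 leqNgt -has_count -all_predC.
  by case/andP: all_ge => _; apply: sub_all => y /=; rewrite -leqNgt.
by rewrite addn0 ltn0 ltnNge; apply/negbTE; rewrite negbK; apply: (allP all_ge); apply: mem_nth.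
Qed.

Section Staircase.
Variable n : nat.
Implicit Types (A B : {set 'I_n}) (a b : 'I_n).

Definition card_below A (j : nat) := #|[set a in A | (a < j)%N]|.

Lemma card_belowS A a : card_below A a.+1 = (card_below A a + (a \in A))%N.
Proof.
rewrite /card_below; case: (boolP (a \in A)) => aA; last first.
  rewrite addn0; apply: eq_card => b; rewrite !inE ltnS leq_eqVlt.
  by case: (eqVneq b a) => [->|/negbTE ba]; rewrite ?(negbTE aA) // val_eqE ba.
transitivity #|a |: [set b in A | (b < a)%N]|.
  apply: eq_card => b; rewrite !inE ltnS leq_eqVlt val_eqE.
  by case: eqP => [->|]//=; rewrite aA.
by rewrite cardsU1 inE ltnn andbF addnC.
Qed.

Lemma card_below_le A j : (card_below A j <= #|A|)%N.
Proof. by apply/subset_leq_card/subsetP => a; rewrite inE => /andP[]. Qed.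

Lemma card_below_leq A j : (card_below A j <= j)%N.
Proof.
rewrite /card_below -[X in (_ <= X)%N]card_ord.
pose f a : 'I_j.+1 := inord a.
case: j @f => [|j] f; first by rewrite card_ord leqn0 cards_eq0; apply/eqP/setP => a; rewrite !inE andbF.
rewrite -(card_in_imset (f := fun a => inord a : 'I_j.+1)) ?max_card //.
move=> a b; rewrite !inE => /andP[_ aj] /andP[_ bj] /(congr1 val).
by rewrite /= !inordK // => /val_inj.
Qed.

Lemma card_below0 A : card_below A 0 = 0%N.
Proof. by apply/eqP; rewrite cards_eq0; apply/eqP/setP => a; rewrite !inE ltn0 andbF. Qed.

Lemma card_below_n A : card_below A n = #|A|.
Proof. by apply: eq_card => a; rewrite inE ltn_ord andbT. Qed.

Lemma card_below_inj A B : (forall j, (j <= n)%N -> card_below A j = card_below B j) -> A = B.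
Proof.
move=> h; apply/setP => a.
have := card_belowS A a; rewrite !h ?(ltnW (ltn_ord a)) ?ltn_ord // card_belowS.
by move/addnI; case: (a \in A); case: (a \in B).
Qed.

Lemma kth_elt_lt A k j : (k < #|A|)%N -> (kth_elt A k < j)%N = (k < card_below A j)%N.
Proof.
move=> kA; rewrite /kth_elt sorted_nth_lt.
- congr (_ < _)%N; rewrite (permP (permEl (perm_sort _ _))) count_map.
  by rewrite /card_below cardE -size_filter /enum_mem -filter_predI size_filter -size_filter; congr size; apply: eq_filter => a; rewrite /= inE andbC.
- exact: sort_sorted leq_total _.
- by rewrite size_sort size_map -cardE.
Qed.

(** By [kth_elt_lt], bounds on the [k]-th elements translate into reversed bounds on the counting
    functions. The condition [#|B| <= #|A|] is the case [j = n]. *)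
Lemma tab_leP A B : reflect (forall j, (j <= n)%N -> (card_below B j <= card_below A j)%N)
  (tab_le A B).
Proof.
apply: (iffP andP) => [[BA /forallP h] j _|h].
  rewrite leqNgt; apply/negP => lt.
  have kB : (card_below A j < #|B|)%N := leq_trans lt (card_below_le _ _).
  have kA : (card_below A j < #|A|)%N by apply: leq_trans kB BA.
  have := kth_elt_lt j kA; rewrite ltnn => /negbT; rewrite -leqNgt => jk.
  have := kth_elt_lt j kB; rewrite lt => kj.
  by have := leq_trans kj (leq_trans jk (h (Ordinal kB))); rewrite ltnn.
have BA : (#|B| <= #|A|)%N by rewrite -!card_below_n h.
split=> //; apply/forallP => k; have kA := leq_trans (ltn_ord k) BA.
rewrite -ltnS kth_elt_lt //.
have : (k < card_below B (kth_elt B k).+1)%N by rewrite -kth_elt_lt.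
have [jn|jn] := leqP (kth_elt B k).+1 n; first by move=> /leq_trans; apply; apply: h.
move=> _; suff -> : card_below A (kth_elt B k).+1 = #|A| by [].
by apply: eq_card => a; rewrite inE (leq_trans (ltn_ord a)) ?andbT // ltnW.
Qed.

(* A cell [(k, j)] of the shifted staircase stands for the condition that [A]
   has more than [k] elements [<= j]; the cell [(0, n-1)], which holds for all
   nonempty [A], is left out. *)
Definition cell := {p : 'I_n * 'I_n |
  (p.1 <= p.2)%N && ~~ ((p.1 == 0 :> nat) && (p.2 == n.-1 :> nat))}.
Implicit Types q : cell.

Definition cells A : {set cell} :=
  [set q : cell | ((val q).1 < card_below A (val q).2.+1)%N].

(** The counts [card_below A j] grow with [j], and by at most one per step; accordingly the
    condition at [q'] implies the one at [q]. *)
Definition cell_low q q' :=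
  ((val q).1 == (val q').1 :> nat) && ((val q).2 == (val q').2.+1 :> nat) ||
  ((val q').1 == (val q).1.+1 :> nat) && ((val q').2 == (val q).2.+1 :> nat).

(** Row by row, each from right to left: going up along [cell_low] leads one place to the left or
    into the next row. *)
Definition cell_label q := ((val q).1 * n + (n.-1 - (val q).2))%N.

Definition nonempty_subset : pred {set 'I_n} := fun A => A != set0.

Lemma card_below_nonempty A : A != set0 -> (0 < card_below A n)%N.
Proof. by rewrite card_below_n card_gt0. Qed.

Lemma cells_sub A B : A != set0 -> (cells B \subset cells A) = tab_le A B.
Proof.
move=> A0; apply/subsetP/tab_leP => [h j jn|h q]; last first.
  by rewrite !inE => /leq_trans; apply; apply: h.
case: j jn => [|j] jn; first by rewrite !card_below0.
(* The cell [(k, j)], with [k] the count of [A], lies in [cells B] but not in [cells A]. It is not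
   the omitted cell because [A] is nonempty. *)
rewrite leqNgt; apply/negP; set k := card_below A _ => lt.
have kj : (k <= j)%N by rewrite -ltnS; apply: leq_trans lt (card_below_leq _ _).
have kn : (k < n)%N by apply: leq_ltn_trans kj jn.
have c : (k <= j)%N && ~~ ((k == 0 :> nat) && (j == n.-1 :> nat)).
  rewrite kj /=; apply/negP => /andP[/eqP k0 /eqP jn1].
  have := card_below_nonempty A0; rewrite -(ltn_predK jn) -jn1 -/k k0 //.
have := h (Sub (Ordinal kn, Ordinal jn) c : cell); rewrite !inE /= lt => /(_ isT).
by rewrite -/k ltnn.
Qed.

Lemma tab_le_anti A B : tab_le A B -> tab_le B A -> A = B.
Proof.
move=> /tab_leP AB /tab_leP BA; apply: card_below_inj => j jn.
by apply/eqP; rewrite eqn_leq AB // BA.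
Qed.

Lemma order_complexE : order_complex_T n =1 chain_complex nonempty_subset cells.
Proof.
move=> s; rewrite /order_complex_T /chain_complex.
case: (boolP [forall a in s, a != set0]) => //= /forall_inP h.
apply: eq_forallb_in => a aS; apply: eq_forallb_in => b bS.
by rewrite !cells_sub ?h.
Qed.

(** After the omitted cell is added, the columns of an ideal are initial segments whose sizes grow
    by 0 or 1 from each column to the next; the set sought consists of the places where the size
    jumps. *)
Lemma cells_surj (S : {set cell}) : (0 < n)%N -> low_closed cell_low S ->
  exists2 A : {set 'I_n}, A != set0 & cells A = S.
Proof.
move=> n0 lowS.
pose P k j := [&& k <= j, j < n & ((k == 0) && (j == n.-1)) ||
  [exists q in S, ((val q).1 == k :> nat) && ((val q).2 == j :> nat)]]%N.
have PI q : (q \in S) = P (val q).1 (val q).2.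
  rewrite /P; have /andP[-> /negbTE ->] := valP q; rewrite ltn_ord /=.
  apply/idP/exists_inP => [qS|[q' q'S /andP[/eqP e1 /eqP e2]]].
    by exists q; rewrite ?eqxx.
  suff -> : q = q' by [].
  by apply: val_inj; rewrite [LHS]surjective_pairing [RHS]surjective_pairing; congr pair; apply: val_inj.
have mkcell k j : (k <= j < n)%N -> (k == 0%N) && (j == n.-1) = false ->
    exists2 q : cell, (val q).1 = k :> nat & (val q).2 = j :> nat.
  case/andP=> kj jn c; have kn := leq_ltn_trans kj jn.
  have cc : (k <= j)%N && ~~ ((k == 0 :> nat) && (j == n.-1 :> nat)).
    by rewrite kj c.
  by exists (Sub (Ordinal kn, Ordinal jn) cc).
have P0 : P 0%N n.-1 by rewrite /P !eqxx /= ltn_predL n0.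
have Pright k j : (j.+1 < n)%N -> P k j -> P k j.+1.
  move=> jn /and3P[kj _ /orP[/andP[_ /eqP e]|/exists_inP[q qS /andP[/eqP e1 /eqP e2]]]].
    lia.
  case: (boolP ((k == 0%N) && (j.+1 == n.-1))) => [c|/negbTE c].
    by rewrite /P jn c (leqW kj).
  have kjn : (k <= j.+1 < n)%N by rewrite jn (leqW kj).
  have [q' e1' e2'] := mkcell k j.+1 kjn c.
  rewrite -e1' -e2' -PI; apply: lowS qS.
  by rewrite /cell_low e1 e2 e1' e2' !eqxx.
have Pdiag k j : P k.+1 j.+1 -> P k j.
  move=> /and3P[kj jn /orP[/andP[]//|/exists_inP[q qS /andP[/eqP e1 /eqP e2]]]].
  have kjn : (k <= j < n)%N by lia.
  have c : (k == 0%N) && (j == n.-1) = false by lia.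
  have [q' e1' e2'] := mkcell k j kjn c.
  rewrite -e1' -e2' -PI; apply: lowS qS.
  by rewrite /cell_low e1 e2 e1' e2' !eqxx orbT.
have Pdown k j : P k.+1 j -> P k j.
  case: j => [/and3P[]//|j] Pkj; apply: Pright; last exact: Pdiag.
  by case/and3P: Pkj.
have Pn j : exists k, ~~ P k j.
  by exists n; apply/negP => /and3P[nj jn _]; move: (leq_ltn_trans nj jn); rewrite ltnn.
pose h j := ex_minn (Pn j).
have Ph k j : P k j = (k < h j)%N.
  rewrite /h; case: ex_minnP => m nPm mmin; have [km|mk] := ltnP k m.
    by apply: contraLR km => /mmin; rewrite -leqNgt.
  apply: contraNF nPm; rewrite -(subnKC mk).
  by elim: (k - m)%N => [|i IH]; rewrite ?addn0 // addnS => /Pdown.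
(* Column sizes shifted by one: column [j] concerns elements at most [j], whereas [card_below]
   counts strictly below its argument. *)
pose H j := if j is j'.+1 then h j' else 0%N.
have HS i : (i < n)%N -> (H i <= H i.+1 <= (H i).+1)%N.
  move=> lin; case: i lin => [|i] lin /=.
    by rewrite leqNgt -Ph; apply/negP => /and3P[].
  apply/andP; split; rewrite leqNgt; apply/negP => lt.
    have : P (h i.+1) i by rewrite Ph.
    by move/(Pright _ _ lin); rewrite Ph ltnn.
  have : P (h i).+1 i.+1 by rewrite Ph.
  by move/Pdiag; rewrite Ph ltnn.
pose A := [set a : 'I_n | (H a < H a.+1)%N].
have HA j : (j <= n)%N -> card_below A j = H j.
  elim: j => [|j IH] jn; first by rewrite card_below0.
  rewrite (card_belowS A (Ordinal jn)) IH ?(ltnW jn) // inE.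
  by have := HS _ jn; simpl; case: (ltnP (H j) (h j)); lia.
exists A.
  rewrite -card_gt0 -card_below_n HA // -(prednK n0) /= -Ph //.
by apply/setP => q; rewrite PI Ph inE HA.
Qed.

Lemma cells_model : (0 < n)%N -> ideal_model nonempty_subset cells cell_low cell_label.
Proof.
move=> n0; split.
- move=> [[k j] c] [[k' j'] c']; rewrite /cell_label /= => e; apply: val_inj => /=.
  have jn := ltn_ord j; have j'n := ltn_ord j'.
  have : k = k' :> nat by nia.
  move=> kk; have jj : j = j' :> nat by rewrite kk in e; nia.
  by rewrite (val_inj kk) (val_inj jj).
- move=> [[k j] c] [[k' j'] c']; rewrite /cell_low /cell_label /=.
  have jn := ltn_ord j; have j'n := ltn_ord j'.
  by case/orP=> /andP[/eqP e1 /eqP e2]; nia.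
- move=> A B A0 B0 e; apply: tab_le_anti; rewrite -cells_sub // ?e //.
- move=> A A0 [[k j] c] [[k' j'] c']; rewrite /cell_low !inE /=.
  case/orP=> /andP[/eqP e1 /eqP e2].
    by rewrite (card_belowS A j) e1 e2 => /leq_trans; apply; apply: leq_addr.
  rewrite (card_belowS A j') e1 e2; case: (_ \in A); lia.
- by move=> S; apply: cells_surj.
Qed.

End Staircase.

(** * Counting maximal chains *)

Section Lagrange.
Local Open Scope ring_scope.

Lemma coef_prod_XsubC (K : comNzRingType) (J : Type) (s : seq J) (z : J -> K) :
  (0 < size s)%N ->
  (\prod_(b <- s) ('X - (z b)%:P))`_(size s).-1 = - \sum_(b <- s) z b.
Proof.
elim: s => // b s IH _; rewrite !big_cons /= mulrBl coefB coefXM coefCM.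
set p := \prod_(_ <- s) _.
have p1 : p`_(size s) = 1.
  have : p \is monic by apply: monic_prod_XsubC.
  by rewrite monicE lead_coefE size_prod_XsubC => /eqP.
rewrite p1 mulr1; case: s IH @p p1 => [|c s] IH p p1 /=.
  by rewrite big_nil addr0 sub0r.
by rewrite IH // opprD addrC.
Qed.

(* Comparing leading coefficients in the Lagrange interpolation, at the points
   [y a], of the polynomial [\prod_a ('X - z a) - \prod_a ('X - y a)]. *)
Lemma lagrange_sum (K : fieldType) (J : finType) (A : {set J}) (y z : J -> K) :
  {in A &, injective y} ->
  \sum_(a in A) (y a - z a) * \prod_(b in A :\ a) ((y a - z b) / (y a - y b)) =
  \sum_(a in A) (y a - z a).
Proof.
move=> yinj; have [->|A0] := eqVneq A set0; first by rewrite !big_set0.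
have cA : (0 < #|A|)%N by rewrite card_gt0.
pose pz := \prod_(b in A) ('X - (z b)%:P); pose py := \prod_(b in A) ('X - (y b)%:P).
pose q a := \prod_(b in A :\ a) ('X - (y b)%:P).
pose c a := (\prod_(b in A) (y a - z b)) / \prod_(b in A :\ a) (y a - y b).
have szE (B : {set J}) (w : J -> K) : size (\prod_(b in B) ('X - (w b)%:P)) = #|B|.+1.
  by rewrite -big_enum size_prod_XsubC cardE.
have moE (B : {set J}) (w : J -> K) : \prod_(b in B) ('X - (w b)%:P) \is monic.
  exact: monic_prod_XsubC.
have coE (B : {set J}) (w : J -> K) : (0 < #|B|)%N ->
    (\prod_(b in B) ('X - (w b)%:P))`_#|B|.-1 = - \sum_(b in B) w b.
  by move=> B0; rewrite -!big_enum cardE coef_prod_XsubC -?cardE.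
have cD a : a \in A -> #|A :\ a| = #|A|.-1 by move=> aA; rewrite (cardsD1 a A) aA.
have sz_top (B : {set J}) (w : J -> K) : (\prod_(b in B) ('X - (w b)%:P))`_#|B| = 1.
  by have := moE B w; rewrite monicE lead_coefE szE => /eqP.
(* The leading terms of [pz] and [py] cancel, so [p] has degree below [#|A|], and the coefficients
   [c] make it vanish at the [#|A|] distinct points. *)
pose p := pz - py - \sum_(a in A) c a *: q a.
have nz a : a \in A -> \prod_(b in A :\ a) (y a - y b) != 0.
  move=> aA; apply/prodf_neq0 => b /setD1P[ba bA]; rewrite subr_eq0.
  by apply: contra ba => /eqP/yinj ->.
have p0 : p = 0.
  apply: (@roots_geq_poly_eq0 _ p [seq y a | a <- enum A]).
  - apply/allP => _ /mapP[a aA ->]; rewrite mem_enum in aA; apply/rootP.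
    have -> : p.[y a] = pz.[y a] - py.[y a] - \sum_(b in A) c b * (q b).[y a].
      rewrite !hornerE horner_sum; congr (_ - _); apply: eq_bigr => b _.
      by rewrite hornerZ.
    have hq b : b \in A -> (q b).[y a] = \prod_(d in A :\ b) (y a - y d).
      by move=> _; rewrite horner_prod; apply: eq_bigr => d _; rewrite !hornerE.
    have -> : py.[y a] = 0.
      by rewrite horner_prod (big_setD1 a) //= !hornerE subrr mul0r.
    have -> : pz.[y a] = \prod_(b in A) (y a - z b).
      by rewrite horner_prod; apply: eq_bigr => d _; rewrite !hornerE.
    have -> : \sum_(b in A) c b * (q b).[y a] = c a * (q a).[y a].
      rewrite (big_setD1 a) //= big1 ?addr0 // => b /setD1P[ba bA].
      have abA : a \in A :\ b by rewrite !inE eq_sym ba.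
      by rewrite hq // (big_setD1 a abA) /= subrr mul0r mulr0.
    by rewrite hq // divfK ?nz // subr0 subrr.
  - by rewrite map_inj_in_uniq ?enum_uniq // => a b; rewrite !mem_enum; exact: yinj.
  - rewrite size_map -cardE; apply/leq_sizeP => j; rewrite leq_eqVlt => /predU1P[<-|lt].
      rewrite !coefB !sz_top subrr sub0r coef_sum big1 ?oppr0 // => a aA.
      rewrite coefZ nth_default ?mulr0 // szE cD //; lia.
    rewrite !coefB coef_sum !nth_default ?szE // subrr sub0r big1 ?oppr0 // => a aA.
    rewrite coefZ nth_default ?mulr0 // szE cD //; lia.
have := congr1 (fun r : {poly K} => r`_#|A|.-1) p0.
rewrite coef0 !coefB !coE // coef_sum opprK => /eqP; rewrite subr_eq0 => /eqP e.
transitivity (\sum_(a in A) (c a *: q a)`_#|A|.-1); last by rewrite -e sumrB addrC.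
apply: eq_bigr => a aA.
rewrite coefZ -(cD a aA) sz_top mulr1 /c (big_setD1 a aA) /= -mulrA; congr (_ * _).
by rewrite prodf_div.
Qed.

End Lagrange.

(** * Schur's product formula and its recursion over covers *)

Section CountFormula.
Variable n : nat.
Implicit Types (A B : {set 'I_n}) (a b c : 'I_n).

(* The parts of the strict partition corresponding to [A] are the numbers
   [n - a] for [a] in [A], the elements of ['I_n] being counted from 0. *)
Definition weight A := (\sum_(a in A) (n - a))%N.

Lemma card_belowE A j : card_below A j = (\sum_(a in A) (a < j))%N.
Proof.
rewrite /card_below -sum1_card big_mkcond [RHS]big_mkcond; apply: eq_bigr => a _.
by rewrite !inE; case: (a \in A); case: (a < j)%N.
Qed.

Lemma sum_card_below A : (\sum_(j < n) card_below A j.+1)%N = weight A.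
Proof.
under eq_bigr => j _ do rewrite card_belowE.
rewrite exchange_big; apply: eq_bigr => a aA.
have -> : (\sum_(j < n) (a < j.+1) = \sum_(0 <= j < n) (a <= j))%N by rewrite big_mkord.
rewrite (big_cat_nat (n := a)) //=; last exact: ltnW.
rewrite big_nat big1 ?add0n => [|j /andP[_ ja]]; last by rewrite leqNgt ja.
rewrite big_nat (eq_bigr (fun=> 1%N)) => [|j /andP[-> _]//].
by rewrite -big_nat sum_nat_const_nat muln1.
Qed.

(** The successor accounts for the omitted cell [p0] of the diagram [S], whose columns have sizes
    [card_below A j.+1]. *)
Lemma card_cells A : A != set0 -> #|cells A|.+1 = weight A.
Proof.
move=> A0; have n0 : (0 < n)%N.
  by case/set0Pn: A0 => a _; apply: leq_ltn_trans (leq0n a) (ltn_ord a).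
pose S := [set p : 'I_n * 'I_n | (p.1 < card_below A p.2.+1)%N].
have nn : (n.-1 < n)%N by rewrite ltn_predL.
pose p0 := (Ordinal n0, Ordinal nn).
have p0S : p0 \in S by rewrite inE /= prednK // card_below_nonempty.
have -> : #|cells A| = #|S :\ p0|.
  rewrite -(card_imset _ val_inj); apply: eq_card => -[k j]; rewrite !inE /=.
  apply/imsetP/andP => [[[[k' j'] /= c]]|[kj kA]].
    rewrite inE /= => kA [-> ->]; split => //.
    by move: c => /andP[_]; apply: contra => /eqP[-> ->] /=; rewrite !eqxx.
  have c : (k <= j)%N && ~~ ((k == 0 :> nat) && (j == n.-1 :> nat)).
    rewrite -ltnS (leq_trans kA (card_below_leq _ _)) /=.
    by apply: contra kj => /andP[/eqP e1 /eqP e2]; apply/eqP; congr pair; apply: val_inj.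
  by exists (Sub (k, j) c); rewrite ?inE.
have -> : #|S :\ p0|.+1 = #|S| by rewrite (cardsD1 p0 S) p0S.
have -> : #|S| = (\sum_(j < n) \sum_(k < n) (k < card_below A j.+1))%N.
  rewrite exchange_big pair_big /= -sum1_card big_mkcond; apply: eq_bigr => -[k j] _.
  by rewrite inE /=; case: ifP.
rewrite -sum_card_below; apply: eq_bigr => j _.
set m := card_below A _; have mn : (m <= n)%N by apply: leq_trans (card_below_leq _ _) _.
have -> : (\sum_(k < n) (k < m) = \sum_(k < n | k < m) 1)%N.
  by rewrite [RHS]big_mkcond; apply: eq_bigr => k _; case: ifP.
by rewrite -(big_ord_widen n (fun=> 1%N) mn) sum1_card card_ord.
Qed.

(** On strict partitions this lowers the part [n - a] by one; a part 1 disappears, which is the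
    branch without successor. *)
Definition move_up A a : {set 'I_n} :=
  if insub a.+1 is Some c then c |: A :\ a else A :\ a.

Definition movable A a := (a \in A) && (if insub a.+1 is Some c then c \notin A else true).

Variant insub_succ_spec a : option 'I_n -> Type :=
  | InsubSome c of (c = a.+1 :> nat) : insub_succ_spec a (Some c)
  | InsubNone of (n = a.+1) : insub_succ_spec a None.

Lemma insub_succP a : insub_succ_spec a (insub a.+1).
Proof.
case: insubP => [c _ e|]; first by constructor.
by rewrite -leqNgt => h; constructor; apply/eqP; rewrite eqn_leq h ltn_ord.
Qed.

Lemma neq_succ a c : c = a.+1 :> nat -> c != a.
Proof. by move=> e; rewrite -val_eqE /= e gtn_eqF. Qed.

Lemma weight_move_up A a : movable A a -> weight A = (weight (move_up A a)).+1.
Proof.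
rewrite /movable /move_up /weight => /andP[aA]; rewrite (big_setD1 a) //=.
case: insub_succP => [c e cA|e _]; last first.
  by rewrite [X in (X - _)%N]e subSn // subnn.
rewrite big_setU1 /=; last by rewrite !inE (negbTE cA) andbF.
by rewrite -addSn e -subSn ?subSS // -e ltn_ord.
Qed.

Lemma card_below_move_up A a j : movable A a ->
  (card_below (move_up A a) j <= card_below A j)%N.
Proof.
rewrite /movable /move_up => /andP[aA].
rewrite !card_belowE [X in (_ <= X)%N](big_setD1 a) //=.
case: insub_succP => [c e cA|e _]; last exact: leq_addl.
rewrite big_setU1 /=; last by rewrite !inE (negbTE cA) andbF.
by rewrite leq_add2r e; case: ltnP => // h; rewrite (ltnW h).
Qed.

Lemma covered_move_up A B : A != set0 -> (0 < #|cells A|)%N ->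
  covered (@nonempty_subset n) (@cells n) A B =
  (B \in [set move_up A a | a in [set a | movable A a]]).
Proof.
move=> A0 cA0; apply/and3P/imsetP => [[B0 BA /eqP cAB]|[a]]; last first.
  rewrite inE => mA ->.
  have B0 : move_up A a != set0.
    have := weight_move_up mA; rewrite -card_cells //; apply: contra_eqN => /eqP ->.
    by rewrite /weight big_set0 eqn_leq (leqNgt _.+1) ltnS cA0.
  split=> //; last by rewrite -eqSS !card_cells // (weight_move_up mA).
  by rewrite cells_sub //; apply/tab_leP => j _; apply: card_below_move_up.
have /tab_leP le : tab_le A B by rewrite -cells_sub.
(* One cell is lost, so the counting functions differ at a single index, and there by one.
   Membership is then read off from differences of successive counts. *)
have : (\sum_(j < n) (card_below A j.+1 - card_below B j.+1) == 1)%N.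
  rewrite sumnB => [|j _]; last exact: le.
  by rewrite !sum_card_below -!card_cells // cAB subSnn.
case/sum_nat_eq1 => a [_ e1 e0].
have leq0 j : j != a -> card_below A j.+1 = card_below B j.+1.
  by move=> ja; apply/eqP; rewrite eqn_leq le // andbT -subn_eq0 e0.
have ea : card_below A a.+1 = (card_below B a.+1).+1.
  by have := le a.+1 (ltn_ord a); lia.
have pre j : j != a -> (j : nat) != a.+1 -> (j \in A) = (j \in B).
  move=> ja ja1; have := leq0 j ja; rewrite !card_belowS.
  suff -> : card_below A j = card_below B j by move/addnI; do 2 case: (_ \in _).
  case: j ja ja1 => -[|j] jn ja ja1; first by rewrite !card_below0.
  by apply: (leq0 (Ordinal (ltnW jn))); move: ja1; rewrite eqSS -val_eqE.
have aAB : (a \in A) && (a \notin B).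
  have : card_below A a = card_below B a.
    case: (posnP a) => [->|a0]; first by rewrite !card_below0.
    have an : (a.-1 < n)%N by apply: leq_ltn_trans (leq_pred _) (ltn_ord a).
    by rewrite -(prednK a0); apply: (leq0 (Ordinal an)); rewrite -val_eqE /=; lia.
  by move: ea; rewrite !card_belowS; case: (a \in A); case: (a \in B); lia.
case/andP: aAB => aA aB.
have succ c : c = a.+1 :> nat -> (c \notin A) && (c \in B).
  move=> ec; have := leq0 c (neq_succ ec); rewrite !card_belowS.
  have -> : card_below A c = (card_below B c).+1 by rewrite ec.
  by case: (c \in A); case: (c \in B); lia.
exists a.
  by rewrite inE /movable aA /=; case: insub_succP => // c /succ/andP[].
apply/setP => b; rewrite /move_up; case: insub_succP => [c ec|en].
  rewrite !inE; case: (eqVneq b c) => [->|bc]; first by case/andP: (succ _ ec).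
  case: (eqVneq b a) => [->|ba] /=; first exact/negbTE.
  by rewrite pre // -ec val_eqE.
rewrite !inE; case: (eqVneq b a) => [->|ba] /=; first exact/negbTE.
by rewrite pre // -en; have := ltn_ord b; lia.
Qed.

Lemma move_up_inj A : {in [set a | movable A a] &, injective (move_up A)}.
Proof.
move=> a b; rewrite !inE => ma mb e; apply/eqP; apply/negPn/negP => ab.
have aA : a \in A by case/andP: ma.
have : a \in move_up A b.
  by rewrite /move_up; case: insub_succP => [c _|_]; rewrite !inE ab aA ?orbT.
rewrite -e /move_up; case: insub_succP => [c ec|_]; rewrite !inE eqxx //= orbF.
by move: (neq_succ ec); rewrite eq_sym => /negbTE ->.
Qed.


Local Open Scope ring_scope.

Let wt a : rat := (n - a)%:R.

Definition pair_ratio a b : rat := `|wt a - wt b| / (wt a + wt b).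

Definition pair_product A : rat :=
  \prod_(a in A) \prod_(b in A) (if (a < b)%N then pair_ratio a b else 1).

(* Schur's formula for the number of shifted standard tableaux. *)
Definition shifted_count A : rat :=
  (weight A)`!%:R / \prod_(a in A) (n - a)`!%:R * pair_product A.

Lemma wt_ge1 a : 1 <= wt a.
Proof. by rewrite /wt ler1n subn_gt0. Qed.

Lemma wt_inj : injective wt.
Proof.
move=> a b /eqP; rewrite eqr_nat => /eqP e; apply: val_inj => /=.
by have := ltn_ord a; have := ltn_ord b; lia.
Qed.

Lemma pair_ratioC a b : pair_ratio a b = pair_ratio b a.
Proof. by rewrite /pair_ratio distrC [wt a + _]addrC. Qed.

Lemma pair_productU1 a A : a \notin A ->
  pair_product (a |: A) = \prod_(b in A) pair_ratio a b * pair_product A.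
Proof.
move=> aA; rewrite /pair_product big_setU1 //= big_setU1 //= ltnn mul1r.
under [X in _ * X]eq_bigr => b bA do rewrite big_setU1 //=.
rewrite big_split /= mulrA -big_split; congr (_ * _); apply: eq_bigr => b bA /=.
have : a != b by apply: contraNneq aA => ->.
rewrite -val_eqE; case: ltngtP => //= _ _; rewrite ?mulr1 ?mul1r //.
exact: pair_ratioC.
Qed.

(** For [c = a.+1] these give [z c = y a], so that a blocked move contributes 0; moreover
    [y a - z a = - 2 * wt a], which turns the right side of [lagrange_sum] into a multiple of the
    weight. *)
Let y a : rat := wt a * (wt a - 1).
Let z a : rat := wt a * (wt a + 1).

Let facN0 B : \prod_(b in B) (n - b)`!%:R != 0 :> rat.
Proof. by apply/prodf_neq0 => b _; rewrite pnatr_eq0 -lt0n fact_gt0. Qed.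

(** For parts [w = wt a] and [u = wt b], [y a - z b] is [(w + u) * (w - 1 - u)] and [y a - y b] is
    [(w - u) * (w - 1 + u)]; the differences [w - u] and [w - 1 - u] never have opposite signs. *)
Lemma pair_ratio_pred a b c : c = a.+1 :> nat -> b != a -> b != c ->
  pair_ratio c b = pair_ratio a b * ((y a - z b) / (y a - y b)).
Proof.
move=> ec ba bc; rewrite /pair_ratio /y /z.
have wc : wt c = wt a - 1 by rewrite /wt ec subnS -subn1 natrB ?subn_gt0.
have wa1 := wt_ge1 a; have wb1 := wt_ge1 b; have wc1 := wt_ge1 c.
have s0 : wt a + wt b != 0 by apply: lt0r_neq0; lra.
have sc0 : wt a - 1 + wt b != 0 by apply: lt0r_neq0; lra.
have d0 : wt a - wt b != 0 by rewrite subr_eq0 (inj_eq wt_inj) eq_sym.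
have f0 : wt a * (wt a - 1) - wt b * (wt b - 1) != 0.
  have -> : wt a * (wt a - 1) - wt b * (wt b - 1) = (wt a - wt b) * (wt a - 1 + wt b) by ring.
  by rewrite mulf_neq0.
rewrite wc.
have [ab|ab] := ltnP a b.
  have cb : (c < b)%N by rewrite ltn_neqAle eq_sym val_eqE bc ec.
  have h1 : wt b <= wt a - 1 by rewrite -wc ler_nat leq_sub2l // ltnW.
  rewrite !ger0_norm ?subr_ge0 //; last by apply: le_trans h1 _; lra.
  by field; rewrite ?f0 ?sc0 ?s0.
have h1 : wt a <= wt b by rewrite ler_nat leq_sub2l.
rewrite !ler0_norm; [|lra|lra].
by field; rewrite ?f0 ?sc0 ?s0.
Qed.

Lemma shifted_count_move_up A a : movable A a ->
  shifted_count (move_up A a) * (weight A)%:R =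
  shifted_count A * wt a * \prod_(b in A :\ a) ((y a - z b) / (y a - y b)).
Proof.
move=> mA; have wA := weight_move_up mA; case/andP: (mA) => aA.
have [B aB AE] : exists2 B : {set 'I_n}, a \notin B & A = a |: B.
  by exists (A :\ a); rewrite ?setD11 // setD1K.
have wa0 : wt a != 0 by apply: lt0r_neq0; have := wt_ge1 a; lra.
have AaB : A :\ a = B by rewrite AE setU1K.
have facA : (n - a)`!%:R = wt a * (n - a).-1`!%:R.
  rewrite -natrM; congr (_%:R).
  by rewrite -[in LHS](prednK (n := n - a)) ?subn_gt0 // factS prednK ?subn_gt0.
have fac0 : (n - a).-1`!%:R != 0 :> rat by rewrite pnatr_eq0 -lt0n fact_gt0.
rewrite /shifted_count wA AaB factS natrM.
have -> : pair_product A = \prod_(b in B) pair_ratio a b * pair_product B.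
  by rewrite AE pair_productU1.
have -> : \prod_(b in A) (n - b)`!%:R = wt a * (n - a).-1`!%:R * \prod_(b in B) (n - b)`!%:R :> rat.
  by rewrite AE big_setU1 //= facA.
have := facN0 B; set PB := \prod_(b in B) _`!%:R => PB0.
set w := weight (move_up A a); rewrite /move_up AaB; case: insub_succP => [c ec|en] cA.
  have cB : c \notin B by apply: contra cA => cB; rewrite AE inE cB orbT.
  rewrite pair_productU1 // big_setU1 //= -/PB.
  have -> : (n - c)%N = (n - a).-1 by lia.
  have -> : \prod_(b in B) pair_ratio c b = \prod_(b in B) pair_ratio a b *
      \prod_(b in B) ((y a - z b) / (y a - y b)).
    rewrite -big_split; apply: eq_bigr => b bB /=; apply: pair_ratio_pred => //.
      by apply: contraNneq aB => <-.
    by apply: contraNneq cB => <-.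
  by field; rewrite fac0 PB0 wa0.
have wa1 : wt a = 1 by rewrite /wt {1}en subSn // subnn.
have -> : (n - a).-1`! = 1%N by rewrite {1}en subSn // subnn.
(* A deleted part 1 takes its pair ratios with it; they cancel against the interpolation factors. *)
have E : \prod_(b in B) pair_ratio a b * \prod_(b in B) ((y a - z b) / (y a - y b)) = 1.
  rewrite -big_split big1 //= => b bB; rewrite /pair_ratio /y /z wa1.
  have ba : b != a by apply: contraNneq aB => <-.
  have wb1 : wt b - 1 != 0 by rewrite -wa1 subr_eq0 (inj_eq wt_inj).
  have wb2 := wt_ge1 b; rewrite ler0_norm; last by lra.
  have wb3 : 1 + wt b != 0 by apply: lt0r_neq0; lra.
  have wb4 : wt b != 0 by apply: lt0r_neq0; lra.
  by rewrite subrr mulr0 !sub0r; field; rewrite wb1 wb4 wb3.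
move: E; move: (\prod_(b in B) pair_ratio a b) => p1.
move: (\prod_(b in B) (_ / _)) => p2 E.
by rewrite wa1 -/PB -[LHS]mulr1 -[X in _ * X = _]E; field.
Qed.

Lemma weight_gt0 A : A != set0 -> (0 < weight A)%N.
Proof. by move=> /card_cells <-. Qed.

(** Multiplied by [weight A], the sum extends to all of [A], since blocked moves contribute 0, and
    [lagrange_sum] evaluates it. *)
Lemma shifted_count_rec A : A != set0 ->
  \sum_(a in [set a | movable A a]) shifted_count (move_up A a) = shifted_count A.
Proof.
move=> A0; have w0 : (weight A)%:R != 0 :> rat by rewrite pnatr_eq0 -lt0n weight_gt0.
apply: (mulIf w0); rewrite mulr_suml.
transitivity (\sum_(a in A) shifted_count A * wt a *
    \prod_(b in A :\ a) ((y a - z b) / (y a - y b))).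
  rewrite big_mkcond [RHS]big_mkcond; apply: eq_bigr => a _; rewrite inE.
  have [mA|nmA] := boolP (movable A a).
    by rewrite (shifted_count_move_up mA); case/andP: mA => ->.
  case: ifP => // aA; move: nmA; rewrite /movable aA /=.
  case: insub_succP => // c ec; rewrite negbK => cA.
  rewrite (big_setD1 c) /=; last by rewrite !inE cA neq_succ.
  have -> : y a - z c = 0.
    have wc : wt c = wt a - 1 by rewrite /wt ec subnS -subn1 natrB ?subn_gt0.
    by rewrite /y /z wc; ring.
  by rewrite !mul0r mulr0.
have yinj : {in A &, injective y}.
  move=> a b _ _; rewrite /y => e; have wa1 := wt_ge1 a; have wb1 := wt_ge1 b.
  apply: wt_inj; apply/eqP; rewrite -subr_eq0.
  have : (wt a - wt b) * (wt a - 1 + wt b) == 0.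
    have -> : (wt a - wt b) * (wt a - 1 + wt b) = wt a * (wt a - 1) - wt b * (wt b - 1).
      by ring.
    by rewrite e subrr.
  by rewrite mulf_eq0 => /orP[//|/eqP h]; lra.
have := lagrange_sum z yinj.
have yz a : y a - z a = - 2 * wt a by rewrite /y /z; ring.
under eq_bigr => a _ do rewrite yz -mulrA.
under [RHS]eq_bigr => a _ do rewrite yz.
rewrite -!mulr_sumr => h.
under eq_bigr => a _ do rewrite -mulrA.
rewrite -mulr_sumr; congr (_ * _).
have <- : \sum_(a in A) wt a = (weight A)%:R by rewrite /weight natr_sum.
by apply: (@mulfI _ (-2)) h; rewrite oppr_eq0 pnatr_eq0.
Qed.

(** Both sides satisfy the same recursion over covers, and both are 1 when [A] has no cells, that
    is, when its only part is 1. *)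
Lemma card_max_chains_staircase A : (0 < n)%N -> A != set0 ->
  (#|max_chains_from (@nonempty_subset n) (@cells n) A|)%:R
  = shifted_count A.
Proof.
move=> n0; have HI := cells_model n0; move: {2}_.+1 (ltnSn #|cells A|) => m.
elim: m A => // m IH A; rewrite ltnS => cm A0.
have [c0|cA] := posnP #|cells A|.
  rewrite (card_max_chains_from0 (D := @nonempty_subset n) A0 c0) /shifted_count.
  have w1 : weight A = 1%N by rewrite -card_cells // c0.
  case/set0Pn: (A0) => a aA.
  have AE : A = [set a].
    apply/eqP; rewrite eq_sym eqEcard sub1set aA cards1 -w1.
    rewrite /weight -sum1_card; apply: leq_sum => b _; by rewrite subn_gt0.
  have a1 : (n - a)%N = 1%N by rewrite -w1 /weight AE big_set1.
  rewrite w1 /pair_product AE !big_set1 a1 ltnn; exact: erefl.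
rewrite (card_max_chains_from HI A0 cA) natr_sum -[RHS]shifted_count_rec //.
rewrite -(big_imset (h := move_up A) shifted_count (@move_up_inj A)) /=.
rewrite (eq_bigl _ _ (fun B => covered_move_up B A0 cA)); apply: eq_bigr => B.
rewrite -covered_move_up // => /and3P[B0 _ /eqP cAB].
by apply: IH => //; rewrite -ltnS -cAB ltnS.
Qed.

End CountFormula.

(** * Evaluation of the count at the full set *)

Section FullSet.
Local Open Scope ring_scope.

Lemma prod_fact_rising i : (i.+1`! * \prod_(j < i) (i + j).+2 = (i.*2.+1)`!)%N.
Proof.
suff h m : (i.+1`! * \prod_(j < m) (i + j).+2 = (i + m).+1`!)%N by rewrite h addnn.
elim: m => [|m IH]; first by rewrite big_ord0 muln1 addn0.
by rewrite big_ord_recr /= mulnA IH addnS [RHS]factS mulnC.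
Qed.

Lemma prod_sub_fact i : (\prod_(j < i) (i - j) = i`!)%N.
Proof.
elim: i => [|i IH]; first by rewrite big_ord0.
rewrite big_ord_recl subn0 factS -IH; congr (_ * _)%N.
Qed.

Lemma weight_setT n : weight [set: 'I_n] = 'C(n.+1, 2).
Proof.
rewrite -bin2_sum /weight big_mkord big_ord_recl add0n.
rewrite (eq_bigl predT) => [|a]; last by rewrite inE.
rewrite (reindex_inj rev_ord_inj); apply: eq_bigr => a _ /=.
by rewrite subKn // lift0.
Qed.

Lemma pair_product_setT n : pair_product [set: 'I_n] =
  \prod_(i < n) \prod_(j < i) ((i - j)%:R / (i + j).+2%:R).
Proof.
rewrite /pair_product (eq_bigl predT) => [|a]; last by rewrite inE.
rewrite (reindex_inj rev_ord_inj); apply: eq_bigr => i _ /=.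
rewrite (eq_bigl predT) => [|a]; last by rewrite inE.
rewrite (reindex_inj rev_ord_inj) /=.
have lein : (i <= n)%N by exact: ltnW.
rewrite (big_ord_widen n (fun j => (i - j)%:R / (i + j).+2%:R) lein) [RHS]big_mkcond.
apply: eq_bigr => j _; rewrite /pair_ratio !subKn //.
have -> : (n - i.+1 < n - j.+1)%N = (j < i)%N.
  by have := ltn_ord i; have := ltn_ord j; lia.
case: ifP => // ji; congr (_ / _); last by rewrite -natrD addSn addnS.
by rewrite ger0_norm ?subr_ge0 ?ler_nat ?ltnS ?(ltnW ji) // -natrB ?subSS // ltnS ltnW.
Qed.

(** With the parts listed as [i.+1], the factor for [i] has numerator
    [i]![by]prod_sub_fact[and denominator](i.*2.+1)[!] by [prod_fact_rising]. *)
Lemma shifted_count_setT n :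
  shifted_count [set: 'I_n] * (\prod_(1 <= b < n.+1) (2 * b - 1)`!)%N%:R =
  ('C(n.+1, 2)`! * \prod_(1 <= a < n) a`!)%N%:R.
Proof.
rewrite /shifted_count weight_setT pair_product_setT natrM -!mulrA; congr (_ * _).
have -> : \prod_(a in [set: 'I_n]) (n - a)`!%:R = \prod_(i < n) (i.+1)`!%:R :> rat.
  rewrite (eq_bigl predT) => [|a]; last by rewrite inE.
  rewrite (reindex_inj rev_ord_inj); apply: eq_bigr => a _ /=.
  by rewrite subKn.
have -> : (\prod_(1 <= b < n.+1) (2 * b - 1)`! = \prod_(i < n) (i.*2.+1)`!)%N.
  rewrite big_add1 big_mkord; apply: eq_bigr => i _; congr (_`!); by rewrite mul2n doubleS subn1.
have -> : (\prod_(1 <= a < n) a`! = \prod_(i < n) i`!)%N.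
  case: n => [|n]; first by rewrite big_geq // big_ord0.
  by rewrite big_ord_recl mul1n big_add1 big_mkord.
rewrite !natr_prod -prodfV -!big_split /=; apply: eq_bigr => i _.
rewrite -prod_fact_rising natrM prodf_div -!natr_prod prod_sub_fact.
have h1 : (i.+1)`!%:R != 0 :> rat by rewrite pnatr_eq0 -lt0n fact_gt0.
have h2 : (\prod_(j < i) (i + j).+2)%:R != 0 :> rat.
  by rewrite pnatr_eq0 -lt0n prodn_gt0.
by field; rewrite h1 h2.
Qed.

Lemma cells_setT n : cells [set: 'I_n] = setT.
Proof.
apply/setP => q; rewrite !inE card_belowE.
rewrite (eq_bigl predT) => [|a]; last by rewrite inE.
have le := ltn_ord (val q).2; case/andP: (valP q) => kj _.
have -> : (\sum_(a < n) (a < (val q).2.+1) = \sum_(a < n | a < (val q).2.+1) 1)%N.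
  by rewrite [RHS]big_mkcond; apply: eq_bigr => a _; case: ifP.
by rewrite -(big_ord_widen n (fun=> 1%N) le) sum1_card card_ord ltnS.
Qed.

Lemma setT_neq0 n : (0 < n)%N -> [set: 'I_n] != set0.
Proof. by move=> n0; apply/set0Pn; exists (Ordinal n0); rewrite inE. Qed.

Lemma card_cell n : (0 < n)%N -> #|{: cell n}| = ('C(n.+1, 2)).-1.
Proof. by move=> n0; rewrite -weight_setT -card_cells ?setT_neq0 // cells_setT cardsT. Qed.

Lemma card_maxset_staircase n : (0 < n)%N ->
  (#|[set s | maxset (chain_complex (@nonempty_subset n) (@cells n)) s]|
     * \prod_(1 <= b < n.+1) (2 * b - 1)`! = 'C(n.+1, 2)`! * \prod_(1 <= a < n) a`!)%N.
Proof.
move=> n0; rewrite (card_maxset_chains (cells_model n0) (setT_neq0 n0) (cells_setT n)).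
apply/eqP; rewrite -(eqr_nat rat) natrM card_max_chains_staircase ?setT_neq0 //.
by rewrite shifted_count_setT.
Qed.

End FullSet.

From mathcomp Require Import all_classical all_reals all_analysis.
Import numFieldNormedType.Exports.

(** * Gauges and radial homeomorphisms *)

Section Gauge.
Local Open Scope ring_scope.
Local Open Scope classical_set_scope.
Variable R : realType.

Lemma continuous_rV (T : topologicalType) (d : nat) (f : T -> 'rV[R]_d) :
  (forall i, continuous (fun x => f x 0 i)) -> continuous f.
Proof.
move=> fc x A [P Px sPA].
have h : \forall y \near x, forall i : 'I_d, P 0 i (f y 0 i).
  by apply: filter_forall => i; apply: fc; apply: Px.
by apply: filterS h => y hy; apply: sPA => i j; rewrite (ord1 i).
Qed.

Lemma continuous_bigmax (T : topologicalType) (J : Type) (r : seq J) (P : pred J)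
  (z : R) (F : J -> T -> R) : (forall j, P j -> continuous (F j)) ->
  continuous (fun x => \big[Num.max/z]_(j <- r | P j) F j x).
Proof.
move=> Fc; apply: continuous_big Fc => x.
by apply: (@continuous_max R _ fst snd); [apply: cvg_fst|apply: cvg_snd].
Qed.

Lemma continuous_bigmin (T : topologicalType) (J : Type) (r : seq J) (P : pred J)
  (z : R) (F : J -> T -> R) : (forall j, P j -> continuous (F j)) ->
  continuous (fun x => \big[Num.min/z]_(j <- r | P j) F j x).
Proof.
move=> Fc; apply: continuous_big Fc => x.
by apply: (@continuous_min R _ fst snd); [apply: cvg_fst|apply: cvg_snd].
Qed.

Lemma continuous_sum (T : topologicalType) (J : Type) (r : seq J) (P : pred J)
  (F : J -> T -> R) : (forall j, P j -> continuous (F j)) ->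
  continuous (fun x => \sum_(j <- r | P j) F j x).
Proof. by move=> Fc; apply: continuous_big Fc => x; apply: add_continuous. Qed.

Section RealValued.
Variables (T : topologicalType) (f g : T -> R).
Hypotheses (fc : continuous f) (gc : continuous g).

Lemma continuous_subr : continuous (fun x => f x - g x).
Proof. by move=> x; apply: cvgB; [apply: fc|apply: gc]. Qed.

Lemma continuous_oppr : continuous (fun x => - f x).
Proof. by move=> x; apply: cvgN; apply: fc. Qed.

Lemma continuous_addr_cst (c : R) : continuous (fun x => f x + c).
Proof. by move=> x; apply: cvgD; [apply: fc|apply: cvg_cst]. Qed.

Lemma continuous_mulr_cst (c : R) : continuous (fun x => f x * c).
Proof. by move=> x; apply: cvgM; [apply: fc|apply: cvg_cst]. Qed.

Lemma continuous_maxr : continuous (fun x => Num.max (f x) (g x)).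
Proof. by move=> x; apply: (@continuous_max R T f g); [apply: fc|apply: gc]. Qed.

End RealValued.

(** Continuity on the ambient spaces lets such maps be composed without subspace topologies. *)
Definition globally_homeo (X Y : topologicalType) (A : set X) (B : set Y) : Prop :=
  exists (f : X -> Y) (g : Y -> X),
    [/\ (forall x, A x -> B (f x)), (forall y, B y -> A (g y)),
        (forall x, A x -> g (f x) = x), (forall y, B y -> f (g y) = y)
      & continuous f /\ continuous g].

Lemma globally_homeo_trans (X Y Z : topologicalType) (A : set X) (B : set Y) (C : set Z) :
  globally_homeo A B -> globally_homeo B C -> globally_homeo A C.
Proof.
move=> [f [f' [fAB f'BA fK f'K [fc f'c]]]] [g [g' [gBC g'CB gK g'K [gc g'c]]]].
exists (g \o f), (f' \o g'); split.
- by move=> x /fAB/gBC.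
- by move=> z /g'CB/f'BA.
- by move=> x Ax /=; rewrite gK ?fK //; apply: fAB.
- by move=> z Cz /=; rewrite f'K ?g'K //; apply: g'CB.
- split=> x; first by apply: continuous_comp; [apply: fc|apply: gc].
  by apply: continuous_comp; [apply: g'c|apply: f'c].
Qed.

Lemma globally_homeo_homeomorphic (X Y : topologicalType) (A : set X) (B : set Y) :
  globally_homeo A B -> homeomorphic A B.
Proof.
move=> [f [g [h1 h2 h3 h4 [fc gc]]]]; exists f, g; split => //.
by split; apply: continuous_subspaceT.
Qed.

(** Domination of the coordinates makes [a] vanish only at 0 and gives the continuity of [radial]
    there. *)
Definition gauge (d : nat) (a : 'rV[R]_d -> R) : Prop :=
  [/\ continuous a, forall (t : R) y, 0 <= t -> a (t *: y) = t * a y,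
      forall y, 0 <= a y & forall (y : 'rV[R]_d) i, `|y 0 i| <= a y].

(** Each ray is rescaled so that [b] of the image is [a y]; at the origin the division by zero is
    harmless because the vector is 0. *)
Definition radial (d : nat) (a b : 'rV[R]_d -> R) (y : 'rV[R]_d) := (a y / b y) *: y.

Section GaugeZero.
Variables (d : nat) (a : 'rV[R]_d -> R).
Hypothesis ga : gauge a.

Lemma gauge0 : a 0 = 0.
Proof. by case: ga => _ h _ _; have := h 0 0 (lexx _); rewrite scale0r mul0r. Qed.

Lemma gauge_eq0 y : a y = 0 -> y = 0.
Proof.
case: ga => _ _ _ h ay0; apply/rowP => i; rewrite mxE; apply/eqP.
by rewrite -normr_le0 -ay0.
Qed.

End GaugeZero.

Lemma radial_continuous (d : nat) (a b : 'rV[R]_d -> R) :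
  gauge a -> gauge b -> continuous (radial a b).
Proof.
move=> ga gb; apply: continuous_rV => i y0.
have [ac _ a0 _] := ga; have [bc _ b0 bN] := gb.
have -> : (fun y => radial a b y 0 i) = (fun y => a y / b y * y 0 i).
  by apply/funext => y; rewrite mxE.
rewrite /continuous_at.
have [by0|by0] := eqVneq (b y0) 0.
  have y00 := gauge_eq0 gb by0.
  have -> : a y0 / b y0 * y0 0 i = 0 by rewrite y00 mxE mulr0.
  have ay0 : a y @[y --> y0] --> (0 : R).
    by rewrite -(gauge0 ga) -y00; apply: ac.
  have FF : Filter (nbhs (y0 : 'rV[R]_d)) by exact: nbhs_filter.
  apply/(@cvgr0Pnorm_lt _ _ _ _ FF) => e e0; near=> y.
  apply: (@le_lt_trans _ _ `|a y|); last by near: y; move/(@cvgr0Pnorm_lt _ _ _ _ FF): ay0; apply.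
  rewrite (ger0_norm (a0 y)) normrM ger0_norm ?divr_ge0 //.
  rewrite -mulrA -[X in _ <= X]mulr1 ler_wpM2l //.
  have [->|byN] := eqVneq (b y) 0; first by rewrite invr0 mul0r.
  by rewrite mulrC ler_pdivrMr ?mul1r // lt_neqAle eq_sym byN b0.
have FF : Filter (nbhs (y0 : 'rV[R]_d)) by exact: nbhs_filter.
apply: cvgM; last exact: coord_continuous.
apply: cvgM; first exact: ac.
by apply: cvgV; [exact: by0|exact: bc].
Unshelve. all: by end_near. Qed.

Lemma radial_gauge (d : nat) (a b : 'rV[R]_d -> R) y : gauge a -> gauge b ->
  b (radial a b y) = a y.
Proof.
move=> ga gb; have [_ _ a0 _] := ga; have [_ bZ b0 _] := gb.
rewrite /radial bZ ?divr_ge0 //.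
have [/(gauge_eq0 gb) ->|by0] := eqVneq (b y) 0; last by rewrite divfK.
by rewrite !gauge0 // mulr0.
Qed.

Lemma radialK (d : nat) (a b : 'rV[R]_d -> R) y : gauge a -> gauge b ->
  radial b a (radial a b y) = y.
Proof.
move=> ga gb; rewrite {1}/radial radial_gauge //.
have [_ aZ a0 _] := ga; have [_ _ b0 _] := gb.
have [y0|ay] := eqVneq (a y) 0.
  by rewrite (gauge_eq0 ga y0) /radial !scaler0.
have by0 : b y != 0 by apply: contraNneq ay => /(gauge_eq0 gb) ->; rewrite gauge0.
rewrite /radial aZ ?divr_ge0 // scalerA -[RHS]scale1r; congr (_ *: _).
by field; rewrite ay by0.
Qed.

Lemma gauge_homeo (d : nat) (a b : 'rV[R]_d -> R) : gauge a -> gauge b ->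
  globally_homeo [set y | a y <= 1] [set y | b y <= 1].
Proof.
move=> ga gb; exists (radial a b), (radial b a); split=> /=.
- by move=> x; rewrite radial_gauge.
- by move=> x; rewrite radial_gauge.
- by move=> x _; rewrite radialK.
- by move=> x _; rewrite radialK.
- by split; apply: radial_continuous.
Qed.

Lemma euclid_gauge (d : nat) :
  gauge (fun y : 'rV[R]_d => Num.sqrt (\sum_i y 0 i ^+ 2)).
Proof.
have sq0 (y : 'rV[R]_d) : 0 <= \sum_i y 0 i ^+ 2 by apply: sumr_ge0 => i _; apply: sqr_ge0.
split.
- move=> y; apply: continuous_comp; last exact: sqrt_continuous.
  apply: (@continuous_sum _ _ _ _ (fun i (y : 'rV[R]_d) => y 0 i ^+ 2)) => i _ z.
  by apply: (@continuous_comp _ _ _ (fun y : 'rV[R]_d => y 0 i) (fun t => t ^+ 2));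
    [apply: coord_continuous|apply: exprn_continuous].
- move=> t y t0.
  under eq_bigr => i _ do rewrite mxE exprMn.
  by rewrite -mulr_sumr sqrtrM ?sqr_ge0 // sqrtr_sqr ger0_norm.
- by move=> y; apply: sqrtr_ge0.
- move=> y i; rewrite -sqrtr_sqr ler_sqrt // (bigD1 i) //= lerDl.
  by apply: sumr_ge0 => j _; apply: sqr_ge0.
Qed.

Lemma euclid_ballE (d : nat) :
  euclid_ball R d = [set y | Num.sqrt (\sum_i y 0 i ^+ 2) <= 1].
Proof.
apply/seteqP; split=> y; rewrite /euclid_ball /=.
  by move=> h; rewrite -sqrtr1 ler_wsqrtr.
by rewrite -[X in _ <= X]sqrtr1 ler_sqrt.
Qed.

End Gauge.

(** * The order polytope *)

Section OrderPolytope.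
Local Open Scope ring_scope.
Variables (R : realType) (V Q : finType) (D : pred V) (I : V -> {set Q}).
Variables (low : rel Q) (om : Q -> nat).
Hypothesis HI : ideal_model D I low om.
Implicit Types (x : V -> R) (f : Q -> R) (u v : V) (q : Q).

Definition in_realization x : Prop :=
  [/\ forall v, 0 <= x v, \sum_v x v = 1 &
      chain_complex D I [set v | x v != 0]].

Definition in_order_polytope f : Prop :=
  (forall q, 0 <= f q <= 1) /\ (forall q q', low q q' -> f q' <= f q).

Definition level_map x q := \sum_(v | q \in I v) x v.

(** The defaults 1 and 0 are the values of [f] at a minimum and a maximum adjoined to [Q]; they
    serve the empty and the full ideal. *)
Definition level_inv f v : R :=
  if D v then Num.max 0 (\big[Num.min/1]_(q in I v) f q -
                         \big[Num.max/0]_(q | q \notin I v) f q)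
  else 0.

Lemma level_map_polytope x : in_realization x -> in_order_polytope (level_map x).
Proof.
move=> [x0 x1 /chain_complexP[xD _]]; split=> [q|q q' lo].
  rewrite sumr_ge0 //= -x1 [X in _ <= X](bigID (fun v => q \in I v)) /= lerDl.
  exact: sumr_ge0.
rewrite /level_map big_mkcond [X in _ <= X]big_mkcond ler_sum // => v _.
have [q'v|_] := boolP (q' \in I v); last by case: ifP.
have [xv0|xv] := eqVneq (x v) 0; first by rewrite xv0; case: ifP.
by rewrite (I_closed HI (xD v _) lo q'v) // inE.
Qed.

(** Greedy decomposition: the least value of [f] on [I v] becomes the mass at [v] and is subtracted
    from [f] on [I v]; the induction goes on with [I v] minus one element where the difference
    vanishes. The empty ideal receives the mass that is left. *)
Lemma level_map_onto_below N v f t : D v -> (#|I v| <= N)%N ->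
    (forall q, 0 <= f q <= t) -> (forall q q', low q q' -> f q' <= f q) ->
    (forall q, q \notin I v -> f q = 0) -> 0 <= t ->
  exists x, [/\ forall u, 0 <= x u, \sum_u x u = t,
    chain_complex D I [set u | x u != 0],
    forall u, x u != 0 -> I u \subset I v & forall q, level_map x q = f q].
Proof.
elim: N v f t => [|N IH] v f t Dv Nv fb fl f0 t0.
  have Iv0 : I v = finset.set0 by apply/eqP; rewrite -cards_eq0 -leqn0.
  exists (fun u => if u == v then t else 0); split.
  - by move=> u; case: ifP.
  - by rewrite -big_mkcond big_pred1_eq.
  - apply/chain_complexP; split=> [u|u w]; rewrite !inE.
      by case: (u =P v) => [->//|_]; rewrite eqxx.
    case: (u =P v) => [-> _|_]; last by rewrite eqxx.
    by case: (w =P v) => [-> _|_]; [left|rewrite eqxx].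
  - by move=> u; case: (u =P v) => [->//|_]; rewrite eqxx.
  - move=> q; rewrite f0 ?Iv0 ?inE // /level_map big1 // => u qu.
    by case: eqP qu => // ->; rewrite Iv0 inE.
have [/eqP Iv0|Iv0] := boolP (I v == finset.set0).
  by apply: IH => //; rewrite Iv0 cards0.
case/set0Pn: Iv0 => qq qqv.
case: (@arg_minP _ _ _ qq (fun q => q \in I v) f qqv) => q0 q0v q0min.
have q0P : (q0 \in I v) && (f q0 == f q0) by rewrite q0v eqxx.
(* Among the minimizers of [f] on [I v], one with the largest label is maximal in [I v], so that
   removing it leaves an ideal. *)
case: (@arg_maxnP _ q0 (fun q => (q \in I v) && (f q == f q0)) om q0P).
move=> q1 /andP[q1v /eqP fq1] q1max; rewrite -fq1 in q0min.
have [v' Dv' Iv'] : exists2 v', D v' & I v' = I v :\ q1.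
  apply: (I_surj HI) => q q' lo /setD1P[q'1 q'v].
  have qv := I_closed HI Dv lo q'v; rewrite !inE qv andbT.
  apply: contraTneq lo => ->; apply/negP => lo.
  have /q1max : (q' \in I v) && (f q' == f q0).
    by rewrite q'v -fq1 eq_le fl // q0min.
  by rewrite /geq /= leqNgt (low_om HI lo).
pose m := f q1; have m0 : 0 <= m by case/andP: (fb q1).
pose f' q := if q \in I v then f q - m else 0.
have f'0 q : 0 <= f' q.
  by rewrite /f'; case: ifP => // qv; rewrite subr_ge0 q0min.
have mt : m <= t by case/andP: (fb q1).
have [||q q' lo|q||x' [x'0 x't x'c x's x'f]] := IH v' f' (t - m) Dv'.
- by rewrite Iv'; move: Nv; rewrite (cardsD1 q1) q1v.
- move=> q; rewrite f'0 /f'; case: ifP => _; last by rewrite subr_ge0.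
  by rewrite lerD2r; case/andP: (fb q).
- rewrite {1}/f'; case: ifP => // q'v.
  by rewrite /f' (I_closed HI Dv lo q'v) lerD2r fl.
- rewrite Iv' /f' !inE negb_and negbK => /orP[/eqP ->|/negbTE ->//].
  by rewrite q1v /m subrr.
- by rewrite subr_ge0.
have v'v : I v' \subset I v by rewrite Iv' subsetDl.
exists (fun u => x' u + if u == v then m else 0); split.
- by move=> u; apply: addr_ge0 => //; case: ifP.
- by rewrite big_split /= x't -big_mkcond big_pred1_eq subrK.
- have [hD hc] := chain_complexP _ _ _ x'c; apply/chain_complexP.
  have cs u : u \in [set u | x' u + (if u == v then m else 0) != 0] ->
      u = v \/ u \in [set u | x' u != 0].
    by rewrite !inE; case: (u =P v) => [->|_]; [left|rewrite addr0; right].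
  split=> [u /cs[->//|/hD//]|u w /cs[->|us] /cs[->|ws]].
  + by left.
  + by right; apply: fintype.subset_trans _ v'v; apply: x's; rewrite inE in ws.
  + by left; apply: fintype.subset_trans _ v'v; apply: x's; rewrite inE in us.
  + exact: hc.
- move=> u; case: (u =P v) => [->//|_]; rewrite addr0 => /x's h.
  exact: fintype.subset_trans h v'v.
- move=> q; rewrite /level_map big_split /= -/(level_map x' q) x'f /f'.
  rewrite -big_mkcondr; case: ifP => qv.
    rewrite (big_pred1 v) ?subrK // => u /=; case: eqP => [->|]; rewrite ?andbF //.
    by rewrite qv.
  rewrite big1 ?addr0 ?f0 ?qv // => u /andP[qu /eqP uv].
  by rewrite uv qv in qu.
Qed.

Lemma level_map_onto f : in_order_polytope f ->
  exists2 x, in_realization x & forall q, level_map x q = f q.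
Proof.
move=> [fb fl].
have [v Dv Iv] : exists2 v, D v & I v = [set: Q]%SET.
  by apply: (I_surj HI) => q q' _ _; rewrite inE.
have [] := @level_map_onto_below #|Q| v f 1 Dv _ fb fl _ ler01.
- exact: max_card.
- by move=> q; rewrite Iv inE.
by move=> x [h1 h2 h3 _ h4]; exists x.
Qed.

Section Inverse.
Variables (x : V -> R) (v : V).
Hypotheses (xR : in_realization x) (Dv : D v).

Let C : {set V} := [set u | x u != 0]%SET.

Let sum_le (p p' : pred V) (r : V -> R) :
  (forall u, u \in C -> (if p u then x u else 0) <= (if p' u then x u else 0) + r u) ->
  (forall u, 0 <= r u) ->
  \sum_(u | p u) x u <= \sum_(u | p' u) x u + \sum_u r u.
Proof.
move=> h r0; rewrite big_mkcond (big_mkcond p') -big_split /= ler_sum // => u _.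
have [uC|] := boolP (u \in C); first exact: h.
rewrite inE negbK => /eqP ->.
by rewrite !if_same add0r.
Qed.

Lemma level_invK : level_inv (level_map x) v = x v.
Proof.
have [x0 x1 /chain_complexP[hD hc]] := xR.
have C0 u : u \notin C -> x u = 0 by rewrite inE negbK => /eqP.
rewrite /level_inv Dv.
set m := \big[Num.min/1]_(q in I v) _; set M := \big[Num.max/0]_(q | _) _.
apply/eqP; rewrite eq_le; apply/andP; split.
  rewrite ge_max x0 /= lerBlDr addrC.
  (* Choose [q] in [I v] outside the largest ideal of the support not containing [I v]; then every
     ideal of the support through [q] contains [I v]. If there is no such ideal, the bound [m <= 1]
     is enough. *)
  have [pa pam paP] : exists2 pa : pred V, m <= \sum_(u | pa u) x u &
      forall u, u \in C -> pa u -> I v \subset I u.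
    have [/forall_inP h|] := boolP [forall u in C, I v \subset I u].
      by exists predT => [|u uC _]; [rewrite x1; apply: bigmin_le_id|apply: h].
    rewrite negb_forall_in => /exists_inP[u0 u0C u0v].
    have u0P : (u0 \in C) && ~~ (I v \subset I u0) by rewrite u0C.
    case: (@arg_maxnP _ u0 (fun u => (u \in C) && ~~ (I v \subset I u))
      (fun u => #|I u|) u0P) => w /andP[wC vw] wmax.
    case/fintype.subsetPn: (vw) => q qv qw.
    exists (fun u => q \in I u); first exact: bigmin_le_cond.
    move=> u uC qu; apply: contraT => vu.
    have /wmax : (u \in C) && ~~ (I v \subset I u) by rewrite uC.
    case: (hc _ _ uC wC) => [uw|wu] le; first by rewrite (fintype.subsetP uw) in qw.
    have : I w == I u by rewrite eqEcard wu.
    by move/eqP => e; rewrite e qu in qw.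
  (* Dually, choose [q] outside [I v] in the smallest ideal of the support not included in [I v]; it
     then lies in all of these. *)
  have [pb pbM pbP] : exists2 pb : pred V, \sum_(u | pb u) x u <= M &
      forall u, u \in C -> ~~ (I u \subset I v) -> pb u.
    have [/forall_inP h|] := boolP [forall u in C, I u \subset I v].
      exists pred0 => [|u uC]; last by rewrite h.
      by rewrite big_pred0_eq; apply: bigmax_ge_id.
    rewrite negb_forall_in => /exists_inP[u0 u0C u0v].
    have u0P : (u0 \in C) && ~~ (I u0 \subset I v) by rewrite u0C.
    case: (@arg_minnP _ u0 (fun u => (u \in C) && ~~ (I u \subset I v))
      (fun u => #|I u|) u0P) => w /andP[wC wv] wmin.
    case/fintype.subsetPn: (wv) => q qw qv.
    exists (fun u => q \in I u); first exact: (le_bigmax_cond _ (level_map x) qv).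
    move=> u uC uv.
    have le : (#|I w| <= #|I u|)%N by apply: wmin; rewrite uC.
    case: (hc _ _ uC wC) => [uw|wu]; last exact: (fintype.subsetP wu).
    have : I u == I w by rewrite eqEcard uw.
    by move/eqP ->.
  (* A vertex of the support satisfying [pa] but not [pb] has the ideal [I v], hence is [v]. *)
  apply: le_trans pam _; apply: le_trans (lerD pbM (lexx (x v))).
  have -> : x v = \sum_u (if u == v then x u else 0).
    by rewrite -big_mkcond big_pred1_eq.
  apply: sum_le => [u uC|u]; last by case: ifP.
  case: ifP => [/(paP _ uC) vu|_]; last by apply: addr_ge0; case: ifP.
  have [uv|uv] := boolP (I u \subset I v).
    have -> : u = v.
      by apply: (I_inj HI) => //; [apply: hD|apply/eqP; rewrite finset.eqEsubset uv].
    by rewrite eqxx; case: ifP => _; rewrite ?add0r // lerDl.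
  by rewrite (pbP _ uC uv) lerDl; case: ifP.
have [vC|/C0 ->] := boolP (v \in C); last by rewrite le_max lexx.
rewrite le_max; apply/orP; right; rewrite lerBrDr.
(* For the reverse inequality: on the support, [pb] only selects strict supersets of [I v], all
   selected by [pa], which also selects [v]. *)
have key (pa pb : pred V) : (forall u, u \in C -> I v \subset I u -> pa u) ->
    (forall u, u \in C -> pb u -> ~~ (I u \subset I v)) ->
    \sum_(u | pb u) x u <= \sum_(u | pa u) x u - x v.
  move=> hpa hpb; rewrite lerBrDr.
  have -> : x v = \sum_u (if u == v then x u else 0).
    by rewrite -big_mkcond big_pred1_eq.
  rewrite big_mkcond [X in _ <= X]big_mkcond -big_split ler_sum //= => u _.
  have [uC|/C0 ->] := boolP (u \in C); last by rewrite !if_same addr0.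
  have [->|uv] := eqVneq u v.
    rewrite hpa //; case: ifP; last by rewrite add0r.
    by move/(hpb _ vC); rewrite subxx.
  rewrite addr0; case: ifP => [/(hpb _ uC) nuv|_]; last by case: ifP.
  by rewrite hpa //; case: (hc _ _ uC vC) => // s; rewrite s in nuv.
rewrite addrC; apply/bigmin_geP; split=> [|q qv]; rewrite -lerBrDr; apply/bigmax_leP; split=> [|q' q'v].
- have := key predT pred0; rewrite big_pred0_eq x1; exact.
- have := key predT (fun u => q' \in I u); rewrite x1; apply=> // u uC q'u.
  by apply: contra q'v => /fintype.subsetP; apply.
- have := key (fun u => q \in I u) pred0; rewrite big_pred0_eq; apply=> // u uC /fintype.subsetP; exact.
- apply: key => u uC; first by move/fintype.subsetP; apply.
  by move=> q'u; apply: contra q'v => /fintype.subsetP; apply.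
Qed.

End Inverse.

(** * The order polytope as the unit ball of a gauge *)

Section PolytopeGauge.
Let W := (\max_q om q)%N.

(* An interior point of the order polytope. *)
Definition center q : R := (W.+1 - om q)%:R / W.+2%:R.

Let om_le q : (om q <= W)%N. Proof. exact: leq_bigmax. Qed.

Lemma center_gt0 q : 0 < center q.
Proof. by rewrite divr_gt0 ?ltr0n // subn_gt0 ltnS. Qed.

Lemma center_lt1 q : center q < 1.
Proof. by rewrite ltr_pdivrMr ?ltr0n // mul1r ltr_nat ltnS leq_subr. Qed.

Lemma center_low q q' : low q q' -> center q' < center q.
Proof.
move=> /(low_om HI) lt; rewrite ltr_pM2r ?invr_gt0 ?ltr0n // ltr_nat.
by rewrite ltn_sub2l // ltnS om_le.
Qed.

Implicit Types g : 'rV[R]_#|Q|.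

Let ev g q := g 0 (enum_rank q).

(** One linear form per inequality of the order polytope, translated by [center] and scaled to have
    bound 1. *)
Definition polytope_gauge g : R :=
  Num.max (\big[Num.max/0]_q Num.max (ev g q / (1 - center q)) (- ev g q / center q))
    (\big[Num.max/0]_(p : Q * Q | low p.1 p.2)
       ((ev g p.2 - ev g p.1) / (center p.1 - center p.2))).

Lemma polytope_gaugeP g :
  polytope_gauge g <= 1 <-> in_order_polytope (fun q => ev g q + center q).
Proof.
rewrite ge_max; split=> [/andP[/bigmax_leP[_ h1] /bigmax_leP[_ h2]]|[h1 h2]].
  split=> [q|q q' lo].
    have := h1 q isT; rewrite ge_max ler_pdivrMr ?subr_gt0 ?center_lt1 //.
    by rewrite ler_pdivrMr ?center_gt0 // !mul1r => /andP[? ?]; lra.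
  have := h2 (q, q') lo; rewrite ler_pdivrMr /= ?subr_gt0 ?center_low //.
  by rewrite mul1r; lra.
apply/andP; split; apply/bigmax_leP; split; rewrite ?ler01 //.
  move=> q _; rewrite ge_max ler_pdivrMr ?subr_gt0 ?center_lt1 //.
  by rewrite ler_pdivrMr ?center_gt0 // !mul1r; have := h1 q; lra.
move=> [q q'] /= lo; rewrite ler_pdivrMr /= ?subr_gt0 ?center_low //.
by rewrite mul1r; have := h2 _ _ lo; lra.
Qed.

Lemma polytope_gauge_gauge : gauge polytope_gauge.
Proof.
have evc q : continuous (ev^~ q) by apply: coord_continuous.
split.
- apply: continuous_maxr.
    apply: (continuous_bigmax (F := fun q g => Num.max (ev g q / (1 - center q)) (- ev g q / center q))).
    move=> q _; apply: continuous_maxr; first exact/continuous_mulr_cst/evc.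
    exact/(continuous_mulr_cst (f := fun g => - ev g q))/continuous_oppr/evc.
  apply: (continuous_bigmax (F := fun p g => (ev g p.2 - ev g p.1) / (center p.1 - center p.2))).
  move=> p _; apply: (continuous_mulr_cst (f := fun g => ev g p.2 - ev g p.1)).
  exact: continuous_subr (evc _) (evc _).
- move=> t g t0; rewrite /polytope_gauge maxr_pMr //.
  have bM J (P : pred J) (r : seq J) (F : J -> R) :
      t * \big[Num.max/0]_(j <- r | P j) F j = \big[Num.max/0]_(j <- r | P j) (t * F j).
    by apply: big_morph; [move=> ? ?; apply: maxr_pMr|rewrite mulr0].
  rewrite !bM; congr Num.max; apply: eq_bigr => i _; rewrite /ev !mxE.
    by rewrite maxr_pMr // !mulrA mulrN.
  by rewrite mulrA mulrBr.
- by move=> g; rewrite le_max bigmax_ge_id.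
(* The forms in a single coordinate suffice, as division by a number strictly between 0 and 1 does
   not decrease absolute values. *)
- move=> g i; rewrite le_max; apply/orP; left.
  have gq : g 0 i = ev g (enum_val i) by rewrite /ev enum_valK.
  have c0 := center_gt0 (enum_val i); have c1 := center_lt1 (enum_val i).
  apply: le_trans (le_bigmax_cond _ _ (erefl (xpredT (enum_val i)))) => /=.
  rewrite gq le_max; set z := ev _ _; have [z0|z0] := leP 0 z.
    rewrite ger0_norm // ler_pdivlMr ?subr_gt0 //; apply/orP; left.
    by rewrite -[X in _ <= X]mulr1 ler_wpM2l //; lra.
  rewrite ltr0_norm // [X in _ || X]ler_pdivlMr //; apply/orP; right.
  by rewrite -[X in _ <= X]mulr1 ler_wpM2l; lra.
Qed.

Lemma realization_homeo :
  globally_homeo (geom_realization R (chain_complex D I)) [set g | polytope_gauge g <= 1]%classic.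
Proof.
pose F (x : 'rV[R]_#|V|) : 'rV[R]_#|Q| :=
  \row_i (level_map (fun v => x 0 (enum_rank v)) (enum_val i) - center (enum_val i)).
pose G (g : 'rV[R]_#|Q|) : 'rV[R]_#|V| :=
  \row_j level_inv (fun q => ev g q + center q) (enum_val j).
have realP (x : 'rV[R]_#|V|) : geom_realization R (chain_complex D I) x ->
    in_realization (fun v => x 0 (enum_rank v)).
  move=> [x0 [x1 xc]]; split => //.
  rewrite -x1 [RHS](reindex (@enum_rank V)) //; exact/onW_bij/enum_rank_bij.
have realP' (x : 'rV[R]_#|V|) : in_realization (fun v => x 0 (enum_rank v)) ->
    geom_realization R (chain_complex D I) x.
  move=> [x0 x1 xc]; split; last split => //.
    by move=> i; rewrite -[i]enum_valK.
  rewrite -x1 (reindex (@enum_rank V)) //; exact/onW_bij/enum_rank_bij.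
have Fev (x : 'rV[R]_#|V|) : (fun q => ev (F x) q + center q) = level_map (fun v => x 0 (enum_rank v)).
  by apply/funext => q; rewrite /ev mxE enum_rankK subrK.
have Gev g : (fun v => G g 0 (enum_rank v)) = level_inv (fun q => ev g q + center q).
  by apply/funext => v; rewrite mxE enum_rankK.
have invE x : in_realization x -> level_inv (level_map x) = x.
  move=> xr; apply/funext => v; have [Dv|nDv] := boolP (D v); first exact: level_invK.
  rewrite /level_inv (negbTE nDv); apply/esym/eqP; apply: contraNT nDv => xv.
  by have [_ _ /chain_complexP[hD _]] := xr; apply: hD; rewrite inE.
(* Every point of the polytope is a value of [level_map], so the left inverse [invE] is also a right
   inverse. *)
have polyG g : polytope_gauge g <= 1 -> in_realization (level_inv (fun q => ev g q + center q))
    /\ level_map (level_inv (fun q => ev g q + center q)) = (fun q => ev g q + center q).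
  move=> /polytope_gaugeP/level_map_onto[x xr xE].
  have <- : level_map x = (fun q => ev g q + center q) by apply/funext.
  by rewrite invE.
exists F, G; split.
- move=> x /realP xr; apply/polytope_gaugeP; rewrite Fev; exact: level_map_polytope.
- by move=> g /polyG[h _]; apply: realP'; rewrite Gev.
- move=> x /realP xr; apply/rowP => j.
  by rewrite mxE Fev invE // enum_valK.
- move=> g /polyG[_ h]; apply/rowP => i.
  by rewrite mxE Gev h /ev enum_valK addrK.
split; apply: continuous_rV => i.
  rewrite (_ : (fun x : 'rV[R]_#|V| => F x 0 i) = fun x : 'rV[R]_#|V| =>
      level_map (fun v => x 0 (enum_rank v)) (enum_val i) - center (enum_val i)); last first.
    by apply/funext => x; rewrite mxE.
  apply: (continuous_addr_cst (f := fun x : 'rV[R]_#|V| =>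
    level_map (fun v => x 0 (enum_rank v)) (enum_val i))).
  apply: (continuous_sum (F := fun v (x : 'rV[R]_#|V|) => x 0 (enum_rank v))) => v _.
  exact: coord_continuous.
rewrite (_ : (fun g => G g 0 i) = fun g =>
   level_inv (fun q => ev g q + center q) (enum_val i)); last first.
  by apply/funext => g; rewrite mxE.
rewrite /level_inv; case: (D (enum_val i)); last exact: cst_continuous.
have evc q : continuous (fun g => ev g q + center q).
  exact/continuous_addr_cst/coord_continuous.
apply: continuous_maxr; first exact: cst_continuous.
apply: continuous_subr.
  by apply: (continuous_bigmin (F := fun q g => ev g q + center q)).
by apply: (continuous_bigmax (F := fun q g => ev g q + center q)).
Qed.

Lemma realization_ball :
  homeomorphic (geom_realization R (chain_complex D I)) (euclid_ball R #|Q|).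
Proof.
apply: globally_homeo_homeomorphic; rewrite euclid_ballE.
exact: (globally_homeo_trans realization_homeo (gauge_homeo polytope_gauge_gauge (euclid_gauge _ _))).
Qed.

End PolytopeGauge.
End OrderPolytope.

Theorem mainTheorem9 (R : realType) (n : nat) : (1 <= n)%N ->
  [/\ cohen_macaulay_Z (order_complex_T n),
      homeomorphic (geom_realization R (order_complex_T n))
                   (euclid_ball R ('C(n.+1, 2)).-1)
    & (#|[set s | maxset (order_complex_T n) s]|
         * \prod_(1 <= b < n.+1) (2 * b - 1)`!
       = ('C(n.+1, 2))`! * \prod_(1 <= a < n) a`!)%N].
Proof.
move=> n0.
have -> : order_complex_T n = chain_complex (@nonempty_subset n) (@cells n).
  by apply/funext => s; apply: order_complexE.
have HI := cells_model n0; split.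
- exact: chain_complex_CM HI.
- by rewrite -card_cell //; apply: realization_ball HI.
- exact: card_maxset_staircase.
Qed.
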